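(* Let $P$ be a standard Young tableau. The Knuth class $K(P)$ is pattern-Knuth closed if and only if $P$ is a superstandard tableau of hook shape.
   Context: $\mathfrak{S}_n$ is the set of permutations of $[n]$ in one-line notation. For a permutation $\pi$, $P(\pi)$ denotes its Robinson–Schensted (row) insertion tableau. For a standard Young tableau $P$, the Knuth class is $K(P)=\{\pi\mid P(\pi)=P\}$. A permutation $\sigma$ contains $\pi$ as a pattern if some (not necessarily consecutive) subsequence of $\sigma$ is order-isomorphic to $\pi$; otherwise it avoids $\pi$. For a set $\Pi$ of permutations, $\mathfrak{S}_n(\Pi)$ is the set of $\sigma\in\mathfrak{S}_n$ avoiding every $\pi\in\Pi$. $\Pi$ is called pattern-Knuth closed if $\mathfrak{S}_n(\Pi)$ is a union of Knuth classes for all $n$. Young diagrams are drawn in English notation; a hook is a partition of the form $(a,1^b)$. The row superstandard tableau of shape $\lambda$ is the standard Young tableau whose first row is $1,2,\dots,\lambda_1$, whose second row is $\lambda_1+1,\dots,\lambda_1+\lambda_2$, and so on; the column superstandard tableau is defined similarly by filling the columns from left to right, each from top to bottom, with consecutive integers. A tableau is superstandard if it is row superstandard or column superstandard. *)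

(* Defs.v *)
From mathcomp Require Import all_boot.
Set Implicit Arguments.
Unset Strict Implicit.
Unset Printing Implicit Defensive.

(** A permutation of [n] is its one-line notation, a sequence over 1, ..., n. *)
Definition is_permutation_of (n : nat) (s : seq nat) : bool :=
  perm_eq s (iota 1 n).

Definition is_permutation (s : seq nat) : bool := is_permutation_of (size s) s.

Definition order_isomorphic (s t : seq nat) : Prop :=
  size s = size t /\
  forall i j, i < size s -> j < size s ->
    (nth 0 s i < nth 0 s j) = (nth 0 t i < nth 0 t j).

Definition contains (sigma pi : seq nat) : Prop :=
  exists2 s, subseq s sigma & order_isomorphic s pi.

Definition avoids (sigma pi : seq nat) : Prop := ~ contains sigma pi.

Definition avoidance_class (n : nat) (Pi : seq nat -> Prop) (sigma : seq nat)
    : Prop :=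
  is_permutation_of n sigma /\ forall pi, Pi pi -> avoids sigma pi.

(** A tableau is the list of its rows, from top to bottom (English notation). *)
Definition tableau := seq (seq nat).

Definition entry (T : tableau) (i j : nat) : nat := nth 0 (nth [::] T i) j.

Definition is_partition (la : seq nat) : bool :=
  sorted geq la && (0 \notin la).

Definition is_syt (T : tableau) : Prop :=
  [/\ is_partition (shape T),
      is_permutation (flatten T),
      all (sorted ltn) T
    & forall i j, i.+1 < size T -> j < size (nth [::] T i.+1) ->
        entry T i j < entry T i.+1 j].

Fixpoint row_insert (T : tableau) (x : nat) : tableau :=
  if T is r :: T' then
    let k := find (ltn x) r in
    if k < size r then set_nth 0 r k x :: row_insert T' (nth 0 r k)
    else rcons r x :: T'
  else [:: [:: x]].

Definition insertion_tableau (s : seq nat) : tableau :=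
  foldl row_insert [::] s.

Definition knuth_class (P : tableau) (pi : seq nat) : Prop :=
  is_permutation pi /\ insertion_tableau pi = P.

Definition union_of_knuth_classes (A : seq nat -> Prop) : Prop :=
  exists F : tableau -> Prop,
    (forall T, F T -> is_syt T) /\
    (forall sigma, A sigma <-> exists2 T, F T & knuth_class T sigma).

Definition pattern_knuth_closed (Pi : seq nat -> Prop) : Prop :=
  forall n, union_of_knuth_classes (avoidance_class n Pi).

Definition row_superstandard (la : seq nat) : tableau :=
  reshape la (iota 1 (sumn la)).

Definition column_length (la : seq nat) (j : nat) : nat := count (ltn j) la.

(** The entry in row i and column j (counted from 0) is the number of cells in
    the columns before column j, plus i + 1. *)
Definition column_superstandard (la : seq nat) : tableau :=
  mkseq (fun i => mkseq (fun j => sumn (mkseq (column_length la) j) + i.+1)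
                        (nth 0 la i))
        (size la).

Definition is_superstandard (T : tableau) : Prop :=
  T = row_superstandard (shape T) \/ T = column_superstandard (shape T).

Definition is_hook (la : seq nat) : Prop :=
  exists a b, 0 < a /\ la = a :: nseq b 1.

(* Main.v *)
Require Import Defs.
From mathcomp Require Import all_boot zify.
Set Implicit Arguments.
Unset Strict Implicit.
Unset Printing Implicit Defensive.

(** Two permutations have the same insertion tableau exactly when they are Knuth
    equivalent, so a class of permutations is a union of Knuth classes when it is
    stable under Knuth moves.

    If P is the row superstandard tableau of shape (a, 1^b), a word contains a
    pattern of K(P) iff some letter v ends both an increasing subsequence of
    length a and a decreasing one of length b + 1, and Knuth moves preserve the
    existence of such a v; reversing words handles column superstandard hooks.

    In all other cases we insert one letter into some pi in K(P) to get sigma,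
    and find tau Knuth equivalent to sigma without patterns in K(P).  If P is a
    hook, up to reversal 1..m are in its first row, m+1..j-1 in its first column
    and j is in its first row, with m >= 2 and j >= m+2; then sigma is the reading
    word of P with a new letter m+1 inserted just after j, and tau is obtained by
    moving j to the left of 1..m.  If P is not a hook, it has a corner in row q+1
    and column p+1 with p, q >= 1, and one can choose sigma equivalent to some
    tau made of p decreasing words followed by q increasing words.  Every
    subword of tau is again of this form, hence its insertion tableau does not
    contain that corner. *)

(** * Knuth equivalence *)

(** The obstacle in the negative cases is that [tau] must avoid every member of K(P), so the
    argument rests on what all words of a Knuth class share. For hooks this is the descent of m+1
    before m, and an increasing triple among the letters m-1, ..., j. An occurrence in [tau], which
    has only one letter more than the pattern, raises each letter by 0 or 1. The descent forces all
    letters above m to be raised, and no increasing triple is left for the window in [tau]. For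
    other shapes the shared datum is the length of row q+1: a decreasing word lengthens the first
    row by at most one, and an increasing word makes each lower row at most as long as the old row
    above it. The new letter must fit strictly between two old ones; there the words are doubled,
    which frees the odd letters, and standardised at the end. *)

Inductive keq : seq nat -> seq nat -> Prop :=
| keq_refl w : keq w w
| keq_sym u v : keq u v -> keq v u
| keq_trans u v w : keq u v -> keq v w -> keq u w
| keq_yxz u v x y z : x < y < z ->
    keq (u ++ [:: y, x, z & v]) (u ++ [:: y, z, x & v])
| keq_xzy u v x y z : x < y < z ->
    keq (u ++ [:: x, z, y & v]) (u ++ [:: z, x, y & v]).

Lemma keq_cat u u' v v' : keq u u' -> keq v v' -> keq (u ++ v) (u' ++ v').
Proof.
move=> huu hvv; apply: (@keq_trans _ (u' ++ v)).
  elim: huu => {u u'} [w|u1 v1 _ h|u1 v1 w1 _ h1 _ h2|u1 v1 x y z h|u1 v1 x y z h].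
  - exact: keq_refl.
  - exact: keq_sym.
  - exact: keq_trans h2.
  - by rewrite -!catA; apply: keq_yxz.
  - by rewrite -!catA; apply: keq_xzy.
elim: hvv => {v v'} [w|u1 v1 _ h|u1 v1 w1 _ h1 _ h2|u1 v1 x y z h|u1 v1 x y z h].
- exact: keq_refl.
- exact: keq_sym.
- exact: keq_trans h2.
- by rewrite !catA; apply: keq_yxz.
- by rewrite !catA; apply: keq_xzy.
Qed.

Lemma keq_catl u v v' : keq v v' -> keq (u ++ v) (u ++ v').
Proof. exact/keq_cat/keq_refl. Qed.

Lemma keq_catr u u' v : keq u u' -> keq (u ++ v) (u' ++ v).
Proof. by move=> h; apply: keq_cat h (keq_refl v). Qed.

Lemma keq_cons a v v' : keq v v' -> keq (a :: v) (a :: v').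
Proof. exact: (@keq_catl [:: a]). Qed.

Lemma keq_perm u v : keq u v -> perm_eq u v.
Proof.
elim=> {u v} [//|u v _|u v w _ h1 _ h2|u v x y z _|u v x y z _].
- by rewrite perm_sym.
- exact: perm_trans h2.
- by rewrite perm_cat2l perm_cons (perm_catCA [:: x] [:: z]).
- by rewrite perm_cat2l (perm_catCA [:: x] [:: z]).
Qed.

Lemma keq_rev u v : keq u v -> keq (rev u) (rev v).
Proof.
elim=> {u v} [w|u v _|u v w _ h1 _ h2|u v x y z h|u v x y z h].
- exact: keq_refl.
- exact: keq_sym.
- exact: keq_trans h2.
- rewrite !rev_cat !rev_cons -!cats1 -!catA /=; apply: keq_sym.
  exact: keq_xzy.
- rewrite !rev_cat !rev_cons -!cats1 -!catA /=; apply: keq_sym.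
  exact: keq_yxz.
Qed.

Lemma keq_map (f : nat -> nat) u v :
  {in u &, {mono f : x y / x < y}} -> keq u v -> keq (map f u) (map f v).
Proof.
move=> fm huv; elim: huv fm => {u v}
  [w|u v huv ih|u v w huv h1 _ h2|u v x y z h|u v x y z h] fm.
- exact: keq_refl.
- by apply/keq_sym/ih => x y; rewrite !(perm_mem (keq_perm huv)); apply: fm.
- apply: keq_trans (h1 fm) (h2 _) => x y.
  by rewrite -!(perm_mem (keq_perm huv)); apply: fm.
- rewrite !map_cat /=; apply: keq_yxz.
  by rewrite !fm // !mem_cat !inE eqxx ?orbT.
- rewrite !map_cat /=; apply: keq_xzy.
  by rewrite !fm // !mem_cat !inE eqxx ?orbT.
Qed.

(** If both exchanged letters survive, so does the witness between them in value, and the move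
    survives. Otherwise one of the exchanged letters is deleted and the two words restrict to the
    same word. *)
Lemma keq_filter (p : pred nat) u v :
  (forall x y z, x < y < z -> p x -> p z -> p y) ->
  keq u v -> keq (filter p u) (filter p v).
Proof.
move=> pc; elim=> {u v} [w|u v _|u v w _ h1 _ h2|u v x y z h|u v x y z h].
- exact: keq_refl.
- exact: keq_sym.
- exact: keq_trans h2.
- rewrite !filter_cat; apply: keq_catl => /=.
  have := pc _ _ _ h; case: (p x) => [hh|_]; last exact: keq_refl.
  case: (p z) hh => [-> //|_]; last exact: keq_refl.
  exact: (@keq_yxz [::]).
- rewrite !filter_cat; apply: keq_catl => /=.
  have := pc _ _ _ h; case: (p x) => [hh|_]; last exact: keq_refl.
  case: (p z) hh => [-> //|_]; last exact: keq_refl.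
  exact: (@keq_xzy [::]).
Qed.

(** The letter [z] passes the letters of [D] one by one; each letter just passed serves as witness
    for the next exchange. *)
Lemma keq_hop_dec y z D :
  y < z -> sorted gtn (y :: D) -> keq [:: y, z & D] (y :: rcons D z).
Proof.
elim: D y => [|d D ih] y yz /=; first by move=> _; apply: keq_refl.
case/andP=> dy pD; apply: (@keq_trans _ [:: y, d, z & D]).
  by apply: keq_sym; apply: (@keq_yxz [::]); rewrite dy.
by apply/keq_cons/ih => //; apply: ltn_trans yz.
Qed.

Lemma keq_hop_inc y x R :
  x < y -> sorted ltn (y :: R) -> keq [:: y, x & R] (y :: rcons R x).
Proof.
elim: R y => [|d D ih] y yz /=; first by move=> _; apply: keq_refl.
case/andP=> dy pD; apply: (@keq_trans _ [:: y, d, x & D]).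
  by apply: (@keq_yxz [::]); rewrite dy yz.
by apply/keq_cons/ih => //; apply: ltn_trans yz dy.
Qed.

Lemma rev_gtn s : sorted gtn (rev s) = sorted ltn s.
Proof. by rewrite rev_sorted. Qed.

Lemma rev_ltn s : sorted ltn (rev s) = sorted gtn s.
Proof. by rewrite rev_sorted. Qed.

Lemma keq_inc_hop A z m :
  m < z -> sorted ltn (rcons A m) -> keq (A ++ [:: z; m]) (z :: rcons A m).
Proof.
move=> mz; rewrite -rev_gtn rev_rcons => /(keq_hop_dec mz)/keq_rev.
by rewrite !rev_cons rev_rcons !revK -!cats1 -!catA.
Qed.

Lemma keq_dec_hop C h r :
  h < r -> sorted gtn (rcons C r) -> keq (C ++ [:: h; r]) (h :: rcons C r).
Proof.
move=> mz; rewrite -rev_ltn rev_rcons => /(keq_hop_inc mz)/keq_rev.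
by rewrite !rev_cons rev_rcons !revK -!cats1 -!catA.
Qed.

(** * Row insertion of a word *)

(** Collecting the letters bumped out of one row by a whole word, in order, lets the insertion of
    the word be followed row by row. *)
Fixpoint row_bump (r xs : seq nat) : seq nat * seq nat :=
  if xs is x :: xs' then
    let k := find (ltn x) r in
    if k < size r then
      let p := row_bump (set_nth 0 r k x) xs' in (p.1, nth 0 r k :: p.2)
    else row_bump (rcons r x) xs'
  else (r, [::]).

Lemma foldl_row_insert_cons r T xs :
  foldl row_insert (r :: T) xs =
    (row_bump r xs).1 :: foldl row_insert T (row_bump r xs).2.
Proof. by elim: xs r T => //= x xs ih r T; case: ifP => _; rewrite ih. Qed.

Lemma foldl_row_insert_nil xs :
  xs <> [::] -> foldl row_insert [::] xs = foldl row_insert [:: [::]] xs.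
Proof. by case: xs. Qed.

Lemma row_bump_cat r xs ys :
  row_bump r (xs ++ ys) =
    ((row_bump (row_bump r xs).1 ys).1, (row_bump r xs).2 ++ (row_bump (row_bump r
      xs).1 ys).2).
Proof.
elim: xs r => [|x xs ih] r /=; first by case: (row_bump r ys).
by case: ifP => _; rewrite ih.
Qed.

(** Together with [row_bump_head] this replaces positions in a row by induction on its first
    entry. *)
Lemma row_bump_skip h r xs :
  all (leq h) xs -> row_bump (h :: r) xs = (h :: (row_bump r xs).1, (row_bump r xs).2).
Proof.
elim: xs r => //= x xs ih r /andP[hx hxs].
have -> : (x < h) = false by rewrite ltnNge hx.
by rewrite ltnS /=; case: ifP => _; rewrite ih.
Qed.

Lemma row_bump_head h r x xs :
  x < h ->
  row_bump (h :: r) (x :: xs) = ((row_bump (x :: r) xs).1, h :: (row_bump (x :: r)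
    xs).2).
Proof. by move=> xh /=; rewrite xh. Qed.

Lemma row_bump0 r : row_bump r [::] = (r, [::]).
Proof. by []. Qed.

Lemma row_bump_nil x xs : row_bump [::] (x :: xs) = row_bump [:: x] xs.
Proof. by []. Qed.

Arguments row_bump : simpl never.

Lemma row_bump_single r x :
  (row_bump r [:: x]).2 = [::] \/
  exists2 c, (row_bump r [:: x]).2 = [:: c] & x < c /\ c \in r.
Proof.
elim: r => [|a r ih]; first by left.
case: (ltnP x a) => xa; first by right; exists a; rewrite ?row_bump_head ?inE ?eqxx.
rewrite row_bump_skip /= ?xa //; case: ih => [|[c -> [xc cr]]]; first by left.
by right; exists c; rewrite // inE cr orbT.
Qed.

Lemma row_bump_pair_le r y z : sorted leq r -> y <= z ->
  (row_bump (row_bump r [:: y]).1 [:: z]).2 = [::] \/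
  exists b c, [/\ y < b <= c, (row_bump r [:: y]).2 = [:: b]
                 & (row_bump (row_bump r [:: y]).1 [:: z]).2 = [:: c]].
Proof.
move=> + yz; elim: r => [|a r ih] sr.
  by left; rewrite row_bump_nil row_bump0 row_bump_skip /= ?yz.
case: (ltnP y a) => ya.
  rewrite row_bump_head // row_bump0 row_bump_skip /= ?yz //.
  case: (row_bump_single r z) => [->|[c -> [zc cr]]]; first by left.
  right; exists a, c; split=> //; rewrite ya.
  by have /allP := order_path_min leq_trans sr; apply.
rewrite [row_bump (a :: r) _]row_bump_skip /= ?ya // row_bump_skip /= ?(leq_trans ya)
  //.
exact/ih/path_sorted/sr.
Qed.

(** The letter [z] has just entered the row, so [y] always finds something to bump, and nothing
    larger than [z]. *)
Lemma row_bump_pair_gt r y z : sorted leq r -> y < z ->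
  exists2 d, y < d <= z /\ d \in z :: r &
    (row_bump (row_bump r [:: z]).1 [:: y]).2 = [:: d] /\
    ((row_bump r [:: z]).2 = [::] \/
     exists2 c, z < c & (row_bump r [:: z]).2 = [:: c]).
Proof.
move=> + yz; elim: r => [|a r ih] sr.
  exists z; rewrite ?inE ?eqxx ?yz ?leqnn //.
  by rewrite row_bump_nil row_bump0 row_bump_head //; split=> //; left.
case: (ltnP z a) => za.
  exists z; first by rewrite inE eqxx yz leqnn.
  by rewrite row_bump_head // row_bump0 row_bump_head //; split=> //; right; exists a.
case: (ltnP y a) => ya.
  exists a; first by rewrite ya za !inE eqxx orbT.
  rewrite [row_bump (a :: r) _]row_bump_skip /= ?za // row_bump_head //; split=> //.
  case: (row_bump_single r z) => [->|[c -> [zc cr]]]; first by left.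
  by right; exists c.
rewrite [row_bump (a :: r) _]row_bump_skip /= ?za // row_bump_skip /= ?ya //.
have [d [yd dr] h] := ih (path_sorted sr); exists d => //; split=> //.
by move: dr; rewrite !inE => /orP[->|->]; rewrite ?orbT.
Qed.

(* Unlike [keq], ties are allowed, so that no distinctness is needed along the
   rows of a tableau. *)
Inductive knuth_step : seq nat -> seq nat -> Prop :=
| step_refl u : knuth_step u u
| step_sym u v : knuth_step u v -> knuth_step v u
| step_yxz x y z : x < y <= z -> knuth_step [:: y; x; z] [:: y; z; x]
| step_xzy x y z : x <= y < z -> knuth_step [:: x; z; y] [:: z; x; y].

(** The first entry [a] decides. If [a <= x], all three letters pass it. If [x < a <= y], then [x]
    bumps [a] and the bumped words are b a c and b c a. If [y < a], they are a y c and a c y. Unless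
    [z] bumps nothing, this is again a move of the same kind. *)
Lemma row_bump_yxz r x y z : sorted leq r -> x < y <= z ->
  (row_bump r [:: y; x; z]).1 = (row_bump r [:: y; z; x]).1 /\
  knuth_step (row_bump r [:: y; x; z]).2 (row_bump r [:: y; z; x]).2.
Proof.
move=> + /andP[xy yz]; have xz := leq_trans (ltnW xy) yz.
elim: r => [|a r ih] sr.
  rewrite !row_bump_nil row_bump_head // [row_bump [:: x] _]row_bump_skip /= ?xz //
    ?row_bump_nil ?row_bump0.
  rewrite (row_bump_cat _ [:: z] [:: x]) row_bump_skip /= ?yz // ?row_bump_nil
    ?row_bump0.
  by rewrite row_bump_head //; split=> //; apply: step_refl.
case: (ltnP x a) => xa; last first.
  have [ya za] : a <= y /\ a <= z by lia.
  rewrite !row_bump_skip /= ?xa ?ya ?za //.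
  by have [-> h] := ih (path_sorted sr).
case: (ltnP y a) => ya.
  rewrite !(row_bump_head _ _ ya) (row_bump_head _ _ xy) row_bump_skip /= ?xz //.
  rewrite (row_bump_cat _ [:: z] [:: x]) row_bump_skip /= ?yz //.
  rewrite (row_bump_head _ _ xy) row_bump0; split=> //.
  case: (row_bump_single r z) => [->|[c -> [zc cr]]]; first exact: step_refl.
  apply: step_yxz; rewrite ya /=.
  by have /allP := order_path_min leq_trans sr; apply.
have za := leq_trans ya yz.
rewrite (row_bump_cat _ [:: y] [:: x; z]) (row_bump_cat _ [:: y; z] [:: x]).
rewrite [row_bump _ [:: y]]row_bump_skip /= ?ya // [row_bump _ [:: y;
  z]]row_bump_skip /= ?ya ?za //.
rewrite !(row_bump_head _ _ xa) /= [row_bump (x :: _) _]row_bump_skip /= ?xz //.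
rewrite (row_bump_cat _ [:: y] [:: z]) ?row_bump0; split=> //=.
have [->|[b [c [/andP[yb bc] -> ->]]]] := row_bump_pair_le (path_sorted sr) yz.
  by rewrite cats0; apply: step_refl.
by apply: step_yxz; rewrite bc (leq_ltn_trans ya).
Qed.

Lemma row_bump_xzy r x y z : sorted leq r -> x <= y < z ->
  (row_bump r [:: x; z; y]).1 = (row_bump r [:: z; x; y]).1 /\
  knuth_step (row_bump r [:: x; z; y]).2 (row_bump r [:: z; x; y]).2.
Proof.
move=> + /andP[xy yz]; have xz := leq_ltn_trans xy yz.
elim: r => [|a r ih] sr.
  rewrite !row_bump_nil [row_bump [:: x] _]row_bump_skip /= ?(ltnW xz) ?xy //.
  rewrite ?row_bump_nil (row_bump_head _ _ yz) (row_bump_head _ _ xz) ?row_bump0.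
  by rewrite row_bump_skip /= ?xy // ?row_bump_nil ?row_bump0; split=> //;
    apply: step_refl.
case: (ltnP x a) => xa; last first.
  have [ya za] : a <= y /\ a <= z by lia.
  rewrite !row_bump_skip /= ?xa ?ya ?za //.
  by have [-> h] := ih (path_sorted sr).
have ar := allP (order_path_min leq_trans sr).
(* Here the kind of move changes: with [b] the second entry of the row, x z y bumps a b z while z x
   y bumps a z b. *)
case: (ltnP z a) => za.
  rewrite (row_bump_head _ _ xa) (row_bump_head _ _ za) (row_bump_head _ _ xz).
  rewrite !row_bump_skip /= ?xy ?(ltnW xz) //.
  case: r ih sr ar => [|b r] ih sr ar.
    by rewrite !row_bump_nil row_bump_head // row_bump0; split=> //; apply: step_refl.
  have ab : a <= b by apply: ar; rewrite inE eqxx.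
  rewrite (row_bump_head _ _ (_ : z < b)) ?(row_bump_head _ _ (_ : y < b)) //; try lia.
  rewrite row_bump_head //; split=> //.
  by apply/step_sym/step_yxz; rewrite za.
rewrite (row_bump_cat _ [:: z] [:: x; y]).
rewrite row_bump_head // row_bump_skip /= ?xy ?(ltnW xz) //.
rewrite [row_bump (a :: r) _]row_bump_skip /= ?za // row_bump_head // row_bump_skip
  /= ?xy //.
rewrite (row_bump_cat _ [:: z] [:: y]); split=> //=.
have [d [/andP[yd dz] dr] [-> [->|[c zc ->]]]] := row_bump_pair_gt (path_sorted sr) yz.
  exact: step_refl.
apply: step_xzy; rewrite (leq_ltn_trans dz) // andbT.
by move: dr; rewrite inE => /predU1P[->//|/ar].
Qed.

Lemma row_bump_step r u v : sorted leq r -> knuth_step u v ->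
  (row_bump r u).1 = (row_bump r v).1 /\ knuth_step (row_bump r u).2 (row_bump r v).2.
Proof.
move=> sr; elim=> {u v} [u|u v _ [h1 h2]|x y z h|x y z h].
- by split=> //; apply: step_refl.
- by split=> //; apply: step_sym.
- exact: row_bump_yxz.
- exact: row_bump_xzy.
Qed.

Lemma foldl_row_insert_step T u v : all (sorted leq) T -> knuth_step u v ->
  foldl row_insert T u = foldl row_insert T v.
Proof.
elim: T u v => [|r T ih] u v sT st; last first.
  case/andP: sT => sr sT; rewrite !foldl_row_insert_cons.
  by have [-> h] := row_bump_step sr st; rewrite (ih _ _ sT h).
elim: st => {u v} [u|u v _ ->|x y z /andP[xy yz]|x y z /andP[xy yz]] //=.
  by rewrite xy (ltnNge z y) yz /= xy (ltnNge z x) (leq_trans (ltnW xy) yz).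
rewrite (ltnNge z x) (ltnW (leq_ltn_trans xy yz)) (leq_ltn_trans xy yz) /= yz.
by rewrite (ltnNge y x) xy.
Qed.

(** * Insertion tableaux *)

Lemma insertion_tableau_rcons w x :
  insertion_tableau (rcons w x) = row_insert (insertion_tableau w) x.
Proof. by rewrite /insertion_tableau -cats1 foldl_cat. Qed.

Lemma row_split r x : sorted ltn r -> x \notin r ->
  (all (gtn x) r /\ find (ltn x) r = size r) \/
  exists r1 b r2, [/\ r = r1 ++ b :: r2, all (gtn x) r1, x < b
                    & find (ltn x) r = size r1].
Proof.
move=> sr xr; case: (boolP (has (ltn x) r)) => hr.
  right; set k := find (ltn x) r; have kr : k < size r by rewrite -has_find.
  exists (take k r), (nth 0 r k), (drop k.+1 r); split.
  - by rewrite -drop_nth // cat_take_drop.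
  - apply/allP => y /(nthP 0)[i]; rewrite size_take kr => ik <-.
    have /= xi := before_find 0 ik; rewrite nth_take //= ltn_neqAle leqNgt xi andbT.
    by apply: contraNneq xr => <-; rewrite mem_nth // (ltn_trans ik).
  - exact: nth_find.
  - by rewrite size_take kr.
left; split; last exact: hasNfind.
apply/allP => y yr; move: hr; rewrite -all_predC => /allP/(_ y yr) /=;
  rewrite -leqNgt leq_eqVlt => /predU1P[yx|//].
by rewrite -yx yr in xr.
Qed.

Lemma sorted_ltn_cat s t :
  sorted ltn (s ++ t) = [&& allrel ltn s t, sorted ltn s & sorted ltn t].
Proof. by rewrite !(sorted_pairwise ltn_trans) pairwise_cat. Qed.

Lemma sorted_ltn_cons x s : sorted ltn (x :: s) = all (ltn x) s && sorted ltn s.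
Proof. by rewrite !(sorted_pairwise ltn_trans). Qed.

Lemma sorted_ltn_replace r1 b r2 x :
  all (gtn x) r1 -> x < b -> sorted ltn (r1 ++ b :: r2) ->
  sorted ltn (r1 ++ x :: r2).
Proof.
move=> r1x xb; rewrite !sorted_ltn_cat !sorted_ltn_cons.
case/and3P=> h -> /andP[br2 ->]; rewrite !andbT /=; apply/andP; split; last first.
  by apply/allP => y /(allP br2); apply: ltn_trans.
move: h; rewrite !allrel_consr => /andP[_ ->]; rewrite andbT.
exact: r1x.
Qed.

Lemma sorted_ltn_rcons r x : all (gtn x) r -> sorted ltn r -> sorted ltn (rcons r x).
Proof.
by move=> h s; rewrite -cats1 sorted_ltn_cat s /= !andbT allrel1r.
Qed.

Definition row_above (r s : seq nat) :=
  size s <= size r /\ forall j, j < size s -> nth 0 r j < nth 0 s j.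

(** Standardness without fixing the set of entries, recursive in the rows: tableaux of arbitrary
    words with distinct letters are covered, and insertion can be followed by induction. *)
Fixpoint tab (T : tableau) : Prop :=
  if T is r :: T' then
    [/\ sorted ltn r, r <> [::], row_above r (head [::] T') & tab T']
  else True.

Definition reading_word (T : tableau) : seq nat := flatten (rev T).

Lemma reading_word_cons r T : reading_word (r :: T) = reading_word T ++ r.
Proof. by rewrite /reading_word rev_cons flatten_rcons. Qed.

Lemma perm_reading_word T : perm_eq (reading_word T) (flatten T).
Proof.
elim: T => // r T ih; rewrite reading_word_cons /= perm_sym perm_catC.
by rewrite perm_sym perm_cat2r.
Qed.

Lemma row_insert_split (r : seq nat) T x r1 b r2 :
  r = r1 ++ b :: r2 -> find (ltn x) r = size r1 ->
  row_insert (r :: T) x = (r1 ++ x :: r2) :: row_insert T b.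
Proof.
move=> -> /= ->; rewrite size_cat /= -{1}[size r1]addn0 ltn_add2l /=.
rewrite nth_cat ltnn subnn /=; congr (_ :: _).
rewrite set_nthE size_cat /= -{1}[size r1]addn0 ltn_add2l /=.
by rewrite take_size_cat // drop_cat ltnNge leqnSn /= subSnn /= drop0.
Qed.

Lemma row_insert_append r T x :
  find (ltn x) r = size r -> row_insert (r :: T) x = rcons r x :: T.
Proof. by move=> /= ->; rewrite ltnn. Qed.

Lemma perm_row_insert T x : perm_eq (flatten (row_insert T x)) (x :: flatten T).
Proof.
elim: T x => //= r T ih x; case: ifP => kr /=; last first.
  by rewrite -cats1 -catA /= perm_catC /= perm_cons perm_catC.
rewrite set_nthE kr; set b := nth _ _ _; apply/permP => p.
have e : count p r = count p (take (find (ltn x) r) r)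
                     + (p b + count p (drop (find (ltn x) r).+1 r)).
  by rewrite -[p b + _]/(count p (b :: _)) -drop_nth // -count_cat cat_take_drop.
have /permP/(_ p) := ih b; rewrite /= !count_cat /= e => ->; rewrite -!addnA addnCA;
  congr (_ + (_ + _)); by rewrite addnCA.
Qed.

Lemma perm_insertion_tableau w : perm_eq (flatten (insertion_tableau w)) w.
Proof.
elim/last_ind: w => // w x ih; rewrite insertion_tableau_rcons.
by rewrite (permPl (perm_row_insert _ _)) perm_sym perm_rcons perm_cons perm_sym.
Qed.

(** The entry below [b] exceeds [b], so [b] lands weakly to the left, under an entry smaller than
    itself: an old entry to the left of [b], or [x]. *)
Lemma row_above_bump r s x : sorted ltn r -> x \notin r -> row_above r s ->
  let k := find (ltn x) r in k < size r ->
  row_above (set_nth 0 r k x) (row_bump s [:: nth 0 r k]).1.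
Proof.
move=> sr xr [sz rs] k kr; set b := nth 0 r k.
have xb : x < b by apply: nth_find; rewrite has_find.
have hk : find (ltn b) s <= k.
  case: (ltnP k (size s)) => ks; last by apply: leq_trans (find_size _ _) ks.
  by rewrite leqNgt; apply/negP => /(before_find 0) /=; rewrite rs.
have szs : size (set_nth 0 r k x) = size r by rewrite size_set_nth; lia.
have rb j : j < k -> nth 0 r j < b.
  by move=> jk; rewrite (sorted_ltn_nth ltn_trans) ?inE //; lia.
rewrite /row_bump /row_above; case: ifP => ks /=.
  rewrite szs size_set_nth (maxn_idPr ks); split=> // j js.
  rewrite !nth_set_nth /=; case: (eqVneq j k) => jk; case: eqP => jk0 //.
  - by apply: ltn_trans xb _; rewrite /b -jk rs.
  - by apply: rb; lia.
  - exact: rs.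
have e : find (ltn b) s = size s by apply/eqP; rewrite eqn_leq find_size leqNgt ks.
rewrite size_rcons szs; split; first lia.
move=> j js; rewrite nth_set_nth nth_rcons /=.
case: (ltngtP j (size s)) => [js'|js'|->]; last 2 first.
- by lia.
- by case: eqP => [//|nk]; apply: rb; lia.
case: eqP => [jk|_]; last exact: rs.
by apply: ltn_trans xb _; rewrite /b -jk rs.
Qed.

Lemma head_row_insert T x :
  head [::] (row_insert T x) = (row_bump (head [::] T) [:: x]).1.
Proof. by case: T => //= r T; rewrite /row_bump; case: ifP. Qed.

Lemma tab_row_insert T x :
  tab T -> uniq (x :: flatten T) -> tab (row_insert T x).
Proof.
elim: T x => [|r T ih] x tT.
  by move=> _; split.
case: tT => sr r0 rT tT /= /andP[]; rewrite mem_cat negb_or => /andP[xr xT].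
rewrite cat_uniq => /and3P[_ rT' uT].
have above := row_above_bump sr xr rT.
case: (row_split sr xr) => [[xbig e]|[r1 [b [r2 [e r1x xb k]]]]].
  rewrite e ltnn; split=> //; first exact: sorted_ltn_rcons.
    by case: (r).
  case: rT => sz rs; split; first by rewrite size_rcons; lia.
  by move=> j js; rewrite nth_rcons (leq_trans js sz) rs.
move: above; rewrite k => above.
have kr : size r1 < size r by rewrite e size_cat /=; lia.
have bE : nth 0 r (size r1) = b by rewrite e nth_cat ltnn subnn.
have := row_insert_split T e k; rewrite /= k kr bE => -[eset].
rewrite eset; split.
- by move: sr; rewrite e; apply: sorted_ltn_replace.
- by case: (r1).
- by rewrite head_row_insert -eset -bE; apply: above.
- apply: ih => //=; rewrite uT andbT; apply: contra rT' => bT.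
  by apply/hasP; exists b => //; rewrite e mem_cat inE eqxx orbT.
Qed.

Lemma uniq_insertion_tableau w : uniq (flatten (insertion_tableau w)) = uniq w.
Proof. exact/perm_uniq/perm_insertion_tableau. Qed.

Lemma tab_insertion_tableau w : uniq w -> tab (insertion_tableau w).
Proof.
elim/last_ind: w => // w x ih; rewrite rcons_uniq => /andP[xw uw].
rewrite insertion_tableau_rcons; apply: tab_row_insert; first exact: ih.
by rewrite /= uniq_insertion_tableau uw (perm_mem (perm_insertion_tableau w)) xw.
Qed.

(** Bumping is a sequence of moves. In [r1 b r2 x] the letter [x] hops left over [r2] up to [b];
    then [b] hops left over [r1], ready to be inserted into the rows below, and [x] stays in its
    place. *)
Lemma keq_row_insert T x : tab T -> uniq (x :: flatten T) ->
  keq (rcons (reading_word T) x) (reading_word (row_insert T x)).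
Proof.
elim: T x => [|r T ih] x tT.
  by move=> _; apply: keq_refl.
case: tT => sr r0 rT tT /= /andP[]; rewrite mem_cat negb_or => /andP[xr xT].
rewrite cat_uniq => /and3P[_ rT' uT].
rewrite -[if _ then _ else _]/(row_insert (r :: T) x).
case: (row_split sr xr) => [[xbig e]|[r1 [b [r2 [e r1x xb k]]]]].
  rewrite row_insert_append // !reading_word_cons rcons_cat.
  exact: keq_refl.
rewrite (row_insert_split T e k) !reading_word_cons.
apply: (@keq_trans _ (reading_word T ++ b :: r1 ++ x :: r2)); last first.
  rewrite -cat_rcons; apply/keq_catr/ih => //=; rewrite uT andbT.
  apply: contra rT' => bT.
  by apply/hasP; exists b => //; rewrite e mem_cat inE eqxx orbT.
rewrite rcons_cat; apply: keq_catl.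
move: sr; rewrite e sorted_ltn_cat => /and3P[_ sr1 sbr2].
apply: (@keq_trans _ (r1 ++ [:: b, x & r2])).
  by rewrite rcons_cat; apply/keq_catl/keq_sym; apply: keq_hop_inc.
have := keq_inc_hop xb (sorted_ltn_rcons r1x sr1).
by move/(keq_catr r2); rewrite -!catA /= cat_rcons.
Qed.

Lemma keq_insertion_tableau w :
  uniq w -> keq w (reading_word (insertion_tableau w)).
Proof.
elim/last_ind: w => [|w x ih]; first by move=> _; apply: keq_refl.
rewrite rcons_uniq => /andP[xw uw]; rewrite insertion_tableau_rcons.
apply: keq_trans (keq_row_insert (tab_insertion_tableau uw) _).
  by rewrite -!cats1; apply/keq_catr/ih.
by rewrite /= uniq_insertion_tableau uw (perm_mem (perm_insertion_tableau w)) xw.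
Qed.

Lemma tab_sorted T : tab T -> all (sorted leq) T.
Proof.
elim: T => //= r T ih [sr _ _ /ih->]; rewrite andbT.
by apply: sub_sorted sr => x y /ltnW.
Qed.

Lemma insertion_tableau_keq u v :
  keq u v -> uniq u -> insertion_tableau u = insertion_tableau v.
Proof.
elim=> {u v} [//|u v h ih uv|u v w huv h1 _ h2 uu|u v x y z h uu|u v x y z h uu].
- by rewrite ih // (perm_uniq (keq_perm h)).
- by rewrite h1 // h2 // -(perm_uniq (keq_perm huv)).
- rewrite /insertion_tableau !foldl_cat.
  rewrite -[y :: x :: _]/([:: y; x; z] ++ v) -[y :: z :: _]/([:: y; z; x] ++ v).
  rewrite !foldl_cat; congr foldl; apply: foldl_row_insert_step.
    by apply/tab_sorted/tab_insertion_tableau; move: uu; rewrite cat_uniq => /and3P[].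
  by apply: step_yxz; case/andP: h => -> /ltnW.
- rewrite /insertion_tableau !foldl_cat.
  rewrite -[x :: z :: _]/([:: x; z; y] ++ v) -[z :: x :: _]/([:: z; x; y] ++ v).
  rewrite !foldl_cat; congr foldl; apply: foldl_row_insert_step.
    by apply/tab_sorted/tab_insertion_tableau; move: uu; rewrite cat_uniq => /and3P[].
  by apply: step_xzy; case/andP: h => /ltnW ->.
Qed.

(** * Shapes, patterns and permutations *)

(** Each letter of [R] bumps exactly the letter it will stand above, so [r] is pushed down
    unchanged. This is why inserting a reading word rebuilds the tableau. *)
Lemma row_bump_above R r : sorted ltn R -> row_above R r -> row_bump r R = (R, r).
Proof.
elim: R r => [|x R ih] r; first by case: r => // y r _ [].
rewrite sorted_ltn_cons => /andP[xR sR] ab.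
have xR' : all (leq x) R by apply: sub_all xR => y /ltnW.
case: r ab => [|y r] ab.
  by rewrite row_bump_nil row_bump_skip // ih //; split.
case: ab => sz ab; rewrite row_bump_head; last exact: (ab 0).
by rewrite row_bump_skip // ih //; split=> // j; apply: (ab j.+1).
Qed.

Lemma foldl_row_insert_above T R :
  R <> [::] -> sorted ltn R -> tab T -> row_above R (head [::] T) ->
  foldl row_insert T R = R :: T.
Proof.
elim: T R => [|r T ih] R R0 sR tT ab.
  rewrite foldl_row_insert_nil // foldl_row_insert_cons row_bump_above //.
case: tT => sr r0 rT tT.
by rewrite foldl_row_insert_cons row_bump_above // ih.
Qed.

Lemma insertion_reading_word T : tab T -> insertion_tableau (reading_word T) = T.
Proof.
elim: T => // r T ih [sr r0 rT tT]; rewrite reading_word_cons.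
rewrite /insertion_tableau foldl_cat -/(insertion_tableau _) ih //.
exact: foldl_row_insert_above.
Qed.

(** A letter just inserted is smaller than all later ones, so only original entries are bumped, from
    left to right. *)
Lemma row_bump_subseq r xs : sorted ltn xs -> subseq (row_bump r xs).2 r.
Proof.
elim: r xs => [|a r ih] xs; last first.
  case: xs => [|x xs] sx; first exact: sub0seq.
  have := sx; rewrite sorted_ltn_cons => /andP[xxs sxs].
  have xxs' : all (leq x) xs by apply: sub_all xxs => y /ltnW.
  case: (ltnP x a) => xa; last first.
    rewrite row_bump_skip /= ?xa /=; last first.
      by apply: sub_all xxs' => y; apply: leq_trans.
    exact: subseq_trans (ih _ sx) (subseq_cons _ _).
  by rewrite row_bump_head // row_bump_skip //= eqxx; apply: ih.
elim: xs => // x xs ih; rewrite sorted_ltn_cons => /andP[xxs sxs].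
rewrite row_bump_nil row_bump_skip /=; first exact: ih.
by apply: sub_all xxs => y /ltnW.
Qed.

(** Generalised for induction: [r] is the tail, from column [k] on, of the row above [s]. A letter
    bumped from a column lands weakly to its left, so the lower row cannot outgrow the old upper
    one. *)
Lemma size_row_bump_subseq r k s bs : subseq bs r -> size s <= k + size r ->
  (forall m, k + m < size s -> nth 0 r m < nth 0 s (k + m)) ->
  size (row_bump s bs).1 <= k + size r.
Proof.
elim: r k s bs => [|a r ih] k s bs.
  by rewrite subseq0 => /eqP ->.
move=> sub sz ab; rewrite /= addnS -addSn.
have ab' m : k.+1 + m < size s -> nth 0 r m < nth 0 s (k.+1 + m).
  by rewrite addSnnS => /ab.
case: bs sub => [|b bs] /=; first by rewrite addSnnS.
case: eqP => [->|_] sub; last by apply: ih => //; rewrite addSnnS.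
rewrite /row_bump -/row_bump; case: ifP => fs /=; last first.
  have ks : size s <= k.
    rewrite leqNgt; apply/negP => ks; move/negbT: fs; rewrite -has_find.
    move/hasPn/(_ (nth 0 s k)) => /=; rewrite mem_nth // => /(_ isT).
    by have := ab 0; rewrite addn0 /= => ->.
  apply: ih => //; rewrite size_rcons; first lia.
  by move=> m; lia.
have fk : find (ltn a) s <= k.
  case: (ltnP k (size s)) => ks; last by apply: leq_trans (ltnW fs) ks.
  rewrite leqNgt; apply/negP => /(before_find 0) /=.
  by have := ab 0; rewrite addn0 /= => ->.
apply: ih => //; rewrite size_set_nth (maxn_idPr fs); first by rewrite addSnnS.
move=> m km; rewrite nth_set_nth /=; case: eqP => [e|_]; first lia.
exact: ab'.
Qed.

Lemma head_foldl_row_insert T xs :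
  head [::] (foldl row_insert T xs) = (row_bump (head [::] T) xs).1.
Proof.
elim: xs T => [|x xs ih] T //=; rewrite ih head_row_insert.
by rewrite (row_bump_cat _ [:: x] xs).
Qed.

(* Inserting an increasing word adds a horizontal strip. *)
Lemma size_row_insert_inc T xs i : tab T -> sorted ltn xs ->
  size (nth [::] (foldl row_insert T xs) i.+1) <= size (nth [::] T i).
Proof.
elim: T i xs => [|r T ih] i xs.
  case: xs => [|x xs] _ sx; first by rewrite !nth_nil.
  by rewrite foldl_row_insert_above // nth_default.
move=> [sr r0 rT tT] sx; rewrite foldl_row_insert_cons /=.
have sub := row_bump_subseq r sx.
case: i => [|i] /=; last by apply: ih => //; apply: subseq_sorted sub sr;
  apply: ltn_trans.
rewrite nth0 head_foldl_row_insert; case: rT => sz ab.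
exact: (@size_row_bump_subseq r 0).
Qed.

(** Every letter finds its larger predecessor in the row, hence bumps something. *)
Lemma size_row_bump_dec r x xs : x \in r -> sorted gtn (x :: xs) ->
  size (row_bump r xs).1 = size r.
Proof.
elim: xs r x => //= y xs ih r x xr /andP[yx sx].
have hs : find (ltn y) r < size r by rewrite -has_find; apply/hasP; exists x.
rewrite /row_bump -/row_bump hs /= (ih _ y) ?size_set_nth ?(maxn_idPr hs) //.
by rewrite set_nthE hs mem_cat inE eqxx orbT.
Qed.

Lemma size_head_insert_dec T xs : sorted gtn xs ->
  size (head [::] (foldl row_insert T xs)) <= (size (head [::] T)).+1.
Proof.
rewrite head_foldl_row_insert; move: (head _ T) => r.
case: xs => //= x xs sx; rewrite /row_bump -/row_bump; case: ifP => fs /=.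
  rewrite (size_row_bump_dec (x := x)) //;
    last by rewrite set_nthE fs mem_cat inE eqxx orbT.
  by rewrite size_set_nth (maxn_idPr fs).
by rewrite (size_row_bump_dec (x := x)) ?size_rcons // mem_rcons inE eqxx.
Qed.

(** Pieces may be empty, so the property passes to subwords. *)
Definition dec_inc_pieces (p q : nat) (w : seq nat) :=
  exists ds rs, [/\ w = flatten ds ++ flatten rs, size ds = p, size rs = q,
                    all (sorted gtn) ds & all (sorted ltn) rs].

(** Removing the last increasing word lowers the row index by one, down to the first row; there each
    decreasing word accounts for at most one cell. *)
Lemma size_row_dec_inc_pieces p q w : uniq w -> dec_inc_pieces p q w ->
  size (nth [::] (insertion_tableau w) q) <= p.
Proof.
move=> uw [ds [rs [ew <- <- sds srs]]]; move: w ew uw srs.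
elim/last_ind: rs => [|rs r ih] w ->.
  rewrite cats0 nth0 => _ _; elim/last_ind: ds sds => [|ds d ih] //.
  rewrite all_rcons size_rcons flatten_rcons => /andP[sd sds].
  rewrite /insertion_tableau foldl_cat; apply: leq_trans (size_head_insert_dec _ sd) _.
  exact: ih.
rewrite all_rcons size_rcons flatten_rcons catA cat_uniq.
move=> /and3P[u1 _ _] /andP[sr srs]; rewrite /insertion_tableau foldl_cat.
apply: leq_trans (size_row_insert_inc _ _ sr) _.
  exact: tab_insertion_tableau u1.
exact: ih.
Qed.

(** * Subwords, increasing relabellings and pattern containment *)

Lemma subseq_cat_split (s a b : seq nat) : subseq s (a ++ b) ->
  exists s1 s2, [/\ s = s1 ++ s2, subseq s1 a & subseq s2 b].
Proof.
case/subseqP=> m sm ->; exists (mask (take (size a) m) a), (mask (drop (size a) m) b).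
rewrite !mask_subseq -mask_cat ?cat_take_drop //.
by rewrite size_takel // sm size_cat leq_addr.
Qed.

Lemma subseq_flatten (s : seq nat) L (P : pred (seq nat)) :
  (forall u v, subseq u v -> P v -> P u) -> subseq s (flatten L) -> all P L ->
  exists L', [/\ s = flatten L', size L' = size L & all P L'].
Proof.
move=> Psub; elim: L s => [|l L ih] s.
  by move=> h _; exists [::]; case: s h.
rewrite /=; case/subseq_cat_split=> s1 [s2 [-> s1l s2L]] /andP[Pl PL].
have [L' [-> <- PL']] := ih _ s2L PL.
by exists (s1 :: L'); rewrite /= PL' (Psub _ _ s1l Pl).
Qed.

Lemma dec_inc_pieces_subseq p q s w :
  subseq s w -> dec_inc_pieces p q w -> dec_inc_pieces p q s.
Proof.
move=> sw [ds [rs [e <- <- sds srs]]]; move: sw; rewrite e.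
case/subseq_cat_split=> s1 [s2 [-> h1 h2]].
have sub_gtn u v : subseq u v -> sorted gtn v -> sorted gtn u.
  by apply: subseq_sorted => x y z /= h h'; apply: ltn_trans h' h.
have sub_ltn u v : subseq u v -> sorted ltn v -> sorted ltn u.
  by apply: subseq_sorted; apply: ltn_trans.
have [ds' [-> <- h1']] := subseq_flatten sub_gtn h1 sds.
have [rs' [-> <- h2']] := subseq_flatten sub_ltn h2 srs.
by exists ds', rs'.
Qed.

Lemma sorted_map_mono (f : nat -> nat) s (P : pred nat) :
  {in P &, {mono f : x y / x < y}} -> all P s ->
  sorted ltn (map f s) = sorted ltn s /\ sorted gtn (map f s) = sorted gtn s.
Proof.
move=> fm; elim: s => // x [//|y s] ih /= /and3P[Px Py Ps].
by have [/= -> ->] := ih (introT andP (conj Py Ps)); rewrite !fm.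
Qed.

Lemma dec_inc_pieces_map (f : nat -> nat) p q w :
  {in w &, {mono f : x y / x < y}} -> dec_inc_pieces p q w ->
  dec_inc_pieces p q (map f w).
Proof.
move=> fm [ds [rs [e pd qr sds srs]]].
exists (map (map f) ds), (map (map f) rs); rewrite !size_map; split=> //.
- by rewrite e map_cat !map_flatten.
- rewrite all_map; apply/allP => d dds /=.
  rewrite (sorted_map_mono fm _).2 ?(allP sds) //; apply/allP => x xd.
  suff : x \in w by []; rewrite e mem_cat; apply/orP; left.
  by apply/flattenP; exists d.
- rewrite all_map; apply/allP => d dds /=.
  rewrite (sorted_map_mono fm _).1 ?(allP srs) //; apply/allP => x xd.
  suff : x \in w by []; rewrite e mem_cat; apply/orP; right.
  by apply/flattenP; exists d.
Qed.

Lemma order_isomorphic_map s t : uniq s -> order_isomorphic s t ->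
  exists2 f : nat -> nat, t = map f s & {in s &, {mono f : x y / x < y}}.
Proof.
move=> us [sz h]; exists (fun x => nth 0 t (index x s)).
  apply: (@eq_from_nth _ 0) => [|i ti]; first by rewrite size_map.
  by rewrite (nth_map 0) ?sz // index_uniq ?sz.
move=> x y xs ys /=; rewrite -h ?index_mem // !nth_index //.
Qed.

Lemma map_order_isomorphic (f : nat -> nat) s :
  {in s &, {mono f : x y / x < y}} -> order_isomorphic s (map f s).
Proof.
move=> fm; split=> [|i j hi hj]; first by rewrite size_map.
by rewrite !(nth_map 0) // fm // mem_nth.
Qed.

Lemma order_isomorphic_sym s t : order_isomorphic s t -> order_isomorphic t s.
Proof. by move=> [sz h]; split=> // i j; rewrite -sz => hi hj; rewrite h. Qed.

Lemma contains_embedding sigma pi : uniq pi -> contains sigma pi ->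
  exists2 g : nat -> nat, subseq (map g pi) sigma
                        & {in pi &, {mono g : x y / x < y}}.
Proof.
move=> up [s sub iso].
have [g e gm] := order_isomorphic_map up (order_isomorphic_sym iso).
by exists g; rewrite -?e.
Qed.

Lemma contains_map sigma pi (g : nat -> nat) :
  subseq (map g pi) sigma -> {in pi &, {mono g : x y / x < y}} ->
  contains sigma pi.
Proof.
move=> sub gm; exists (map g pi) => //; apply: order_isomorphic_sym.
exact: map_order_isomorphic.
Qed.

Lemma contains_rev sigma pi : uniq pi -> contains sigma pi ->
  contains (rev sigma) (rev pi).
Proof.
move=> up /(contains_embedding up)[g sub gm]; apply: (contains_map (g := g)).
  by rewrite map_rev subseq_rev.
by move=> x y; rewrite !mem_rev; apply: gm.
Qed.

(** * Permutations, standard tableaux and Knuth classes *)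

Lemma is_permutation_uniq n w : is_permutation_of n w -> uniq w.
Proof. by move/perm_uniq->; apply: iota_uniq. Qed.

Lemma is_permutation_size n w : is_permutation_of n w -> size w = n.
Proof. by move/perm_size->; apply: size_iota. Qed.

Lemma mem_is_permutation n w x : is_permutation_of n w -> (x \in w) = (0 < x <= n).
Proof. by move/perm_mem->; rewrite mem_iota add1n ltnS. Qed.

Lemma is_permutation_keq n u v :
  keq u v -> is_permutation_of n u -> is_permutation_of n v.
Proof. by move/keq_perm; rewrite perm_sym; apply: perm_trans. Qed.

Lemma is_permutation_of_size n w : is_permutation_of n w -> is_permutation w.
Proof. by rewrite /is_permutation => pw; rewrite (is_permutation_size pw). Qed.

Lemma is_permutation_rev n w : is_permutation_of n (rev w) = is_permutation_of n w.
Proof. by apply: (permPl _); rewrite perm_rev. Qed.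

Lemma nth_tab T i : tab T ->
  i.+1 < size T -> row_above (nth [::] T i) (nth [::] T i.+1).
Proof.
elim: T i => // r T ih [|i] [sr r0 rT tT] iT; last exact: ih.
by rewrite /= nth0.
Qed.

Lemma sorted_geq_shape T : tab T -> sorted geq (shape T).
Proof.
elim: T => // r [|s T] ih // [_ _ [sz _] tT] /=.
by rewrite sz; apply: (ih tT).
Qed.

Lemma tab_nonempty T : tab T -> 0 \notin shape T.
Proof.
elim: T => // r T ih [_ r0 _ tT]; rewrite inE negb_or ih // andbT eq_sym.
by case: (r) r0.
Qed.

Lemma tab_rows T : tab T -> all (sorted ltn) T.
Proof. by elim: T => // r T ih [sr _ _ tT] /=; rewrite sr ih. Qed.

Lemma syt_tab T : is_syt T -> tab T.
Proof.
move=> [/andP[sg n0] _ + h]; elim: T sg n0 h => //= r T ih.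
rewrite inE negb_or => pg /andP[r0 T0] h /andP[sr sT]; split=> //.
- by move=> r0'; rewrite r0' in r0.
- case: T pg h {ih T0 sT} => [|s T] /=; first by [].
  move=> /andP[sz _] h; split=> // j js; exact: (h 0).
- apply: ih => //; first exact: path_sorted pg.
  by move=> i j iT; apply: (h i.+1).
Qed.

Lemma syt_insertion_tableau w : is_permutation w -> is_syt (insertion_tableau w).
Proof.
move=> pw; have uw := is_permutation_uniq pw.
have tT := tab_insertion_tableau uw; split.
- by rewrite /is_partition sorted_geq_shape // tab_nonempty.
- have pT := perm_insertion_tableau w; rewrite /is_permutation (perm_size pT).
  exact: perm_trans pw.
- exact: tab_rows.
- by move=> i j iT; have [_] := nth_tab tT iT; apply.
Qed.

Lemma knuth_class_keq P pi : tab P -> knuth_class P pi -> keq pi (reading_word P).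
Proof.
move=> tP [pp <-]; exact/keq_insertion_tableau/is_permutation_uniq/pp.
Qed.

Lemma keq_knuth_class P n pi : tab P -> is_permutation_of n pi ->
  keq pi (reading_word P) -> knuth_class P pi.
Proof.
move=> tP pp h; split; first exact: is_permutation_of_size pp.
by rewrite (insertion_tableau_keq h) ?insertion_reading_word ?(is_permutation_uniq pp).
Qed.

Lemma syt_reading_word P : is_syt P -> is_permutation (reading_word P).
Proof.
move=> [_ pP _ _]; have p := perm_reading_word P.
by rewrite /is_permutation (perm_size p); apply: perm_trans pP.
Qed.

(** The tool for all negative results: if [tau] avoided the whole class, closure would put the Knuth
    class of [tau], hence [sigma], among the avoiders. *)
Lemma closed_keq P n pi sigma tau :
  pattern_knuth_closed (knuth_class P) -> is_permutation_of n sigma ->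
  keq sigma tau -> knuth_class P pi -> contains sigma pi ->
  ~ forall pi', knuth_class P pi' -> avoids tau pi'.
Proof.
move=> cl ps st Kpi sp av; have [F [_ hF]] := cl n.
have pt := is_permutation_keq st ps.
have [T FT [_ eT]] := (hF tau).1 (conj pt av).
have [|_ /(_ pi Kpi)] := (hF sigma).2 _; last exact.
exists T => //; split; first exact: is_permutation_of_size ps.
by rewrite (insertion_tableau_keq st) ?(is_permutation_uniq ps).
Qed.

(** * Crossing chains *)

Lemma subseq2_cons p q a (w : seq nat) :
  subseq [:: p; q] (a :: w) = if p == a then q \in w else subseq [:: p; q] w.
Proof. by rewrite -sub1seq /=; case: eqP. Qed.

Lemma subseq2_mem p q (w : seq nat) : subseq [:: p; q] w -> (p \in w) && (q \in w).
Proof. by move/mem_subseq => h; rewrite !h ?inE ?eqxx ?orbT. Qed.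

Lemma subseq2_cat p q (u v : seq nat) : subseq [:: p; q] (u ++ v) =
  [|| subseq [:: p; q] u, (p \in u) && (q \in v) | subseq [:: p; q] v].
Proof.
elim: u => [|a u ih]; first by [].
rewrite cat_cons !subseq2_cons inE ih; case: (p == a) => //=.
rewrite mem_cat; case: (boolP (subseq _ v)) => [/subseq2_mem/andP[_ ->]|_].
  by rewrite !orbT.
by rewrite orbF.
Qed.

(** Exchanging adjacent letters reverses the order of this one pair only. *)
Lemma subseq2_swap p q s a b (t : seq nat) : ~~ ((p == a) && (q == b)) ->
  subseq [:: p; q] (s ++ [:: a, b & t]) -> subseq [:: p; q] (s ++ [:: b, a & t]).
Proof.
move=> h; rewrite !subseq2_cat !subseq2_cons !inE; move: h.
have := @subseq2_mem p q t; move: (subseq _ t) (subseq _ s).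
case: (p == a); case: (p == b); case: (q == a); case: (q == b);
  case: (q \in t); case: (p \in s) => //=; do !case=> //=; rewrite ?andbF //;
  by move/(_ isT).
Qed.

Lemma subseq2_pivot p q s (t : seq nat) : uniq (s ++ q :: t) ->
  subseq [:: p; q] (s ++ q :: t) = (p \in s).
Proof.
by move=> u; have := uniq_subseq_pivot [:: p] [::] u; rewrite sub1seq sub0seq andbT.
Qed.

Lemma subseq2_pivotl p q s (t : seq nat) : uniq (s ++ p :: t) ->
  subseq [:: p; q] (s ++ p :: t) = (q \in t).
Proof.
by move=> u; have := uniq_subseq_pivot [::] [:: q] u; rewrite sub1seq sub0seq.
Qed.

Lemma subseq2_trans p q r (w : seq nat) : uniq w ->
  subseq [:: p; q] w -> subseq [:: q; r] w -> subseq [:: p; r] w.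
Proof.
move=> uw pq; have /andP[_ qw] := subseq2_mem pq.
move: pq uw; case/splitPr: qw => s t pq uw; move: pq.
rewrite subseq2_pivot // subseq2_pivotl // => ps rt.
by rewrite subseq2_cat ps inE rt !orbT.
Qed.

(** [k] counts the letters before the end [v], so [ltn] gives increasing and [gtn] decreasing
    subsequences of length k+1. Recording only the links between neighbours means that an exchange
    of adjacent letters can break just one kind of link. *)
Fixpoint chain (R : rel nat) (w : seq nat) (k v : nat) : Prop :=
  if k is k'.+1 then exists u, [/\ R u v, subseq [:: u; v] w & chain R w k' u]
  else v \in w.

Section Chain.
Variable R : rel nat.
Hypothesis R_trans : transitive R.
Hypothesis R_irr : irreflexive R.

Lemma chain_gain s a b t k v : ~~ R a b ->
  chain R (s ++ [:: a, b & t]) k v -> chain R (s ++ [:: b, a & t]) k v.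
Proof.
move=> nab; elim: k v => [|k ih] v /=.
  by rewrite !mem_cat !inE; case: (v \in s); case: (v == a); case: (v == b).
case=> u [Ruv uv /ih h]; exists u; split=> //; apply: subseq2_swap uv.
by apply: contra nab => /andP[/eqP <- /eqP <-].
Qed.

Lemma chain_extend w k u v :
  uniq w -> chain R w k u -> R u v -> subseq [:: u; v] w -> chain R w k v.
Proof.
move=> uw; case: k => [_ _ /subseq2_mem/andP[] //|k] [u0 [R0 s0 c0]] Ruv uv.
by exists u0; split=> //; [apply: R_trans Ruv | apply: subseq2_trans uv].
Qed.

(** Only the link from [p] to [q] breaks, and [m] can replace [p] in it: the predecessor of [p] in
    the chain is neither [m] nor [q], since [R] is transitive and irreflexive, so it lies in [s] and
    precedes [m] as well. *)
Lemma chain_witness_before s m p q t k v :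
  uniq (s ++ [:: m, p, q & t]) -> R p m -> R m q ->
  chain R (s ++ [:: m, p, q & t]) k v -> chain R (s ++ [:: m, q, p & t]) k v.
Proof.
move=> uw pm mq; have uw' : uniq (s ++ [:: m, q, p & t]).
  by rewrite (perm_uniq (_ : perm_eq _ (s ++ [:: m, p, q & t]))) //
             perm_cat2l perm_cons (perm_catCA [:: q] [:: p]).
have lift k' : chain R (s ++ [:: m, q, p & t]) k' p ->
               chain R (s ++ [:: m, q, p & t]) k' m.
  case: k' => [_|k'] /=; first by rewrite mem_cat inE eqxx orbT.
  case=> u [up]; move: (uw').
  rewrite -[s ++ _]/(s ++ [:: m; q] ++ p :: t) !catA => uw2.
  rewrite subseq2_pivot // mem_cat !inE => us h; exists u; split=> //.
    exact: R_trans up pm.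
  case/or3P: us => [us|/eqP eu|/eqP eu].
  - by rewrite -!catA subseq2_cat us /= inE eqxx orbT.
  - by have := R_irr m; rewrite eu in up; rewrite (R_trans up pm).
  - by have := R_irr m; rewrite eu in up; rewrite (R_trans mq (R_trans up pm)).
elim: k v => [|k ih] v /=.
  by rewrite !mem_cat !inE; case: (v == p); case: (v == q); rewrite ?orbT.
case=> u [Ruv uv /ih h].
case: (boolP ((u == p) && (v == q))) => [/andP[/eqP eu /eqP ev]|nuv].
  exists m; rewrite ev; split=> //; last by apply: lift; move: h; rewrite {1}eu.
  by rewrite subseq2_cat subseq2_cons eqxx !inE !eqxx !orbT.
exists u; split=> //; move: uv; rewrite -cat_rcons -[s ++ [:: m, q & _]]cat_rcons.
exact: subseq2_swap.
Qed.

(** If the broken link from [p] to [q] is followed by a further letter, that letter also stands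
    after [m], and [m] replaces [q]. If the chain ends at [q], its end becomes [m]; this is the
    second alternative. *)
Lemma chain_witness_after s m p q t k v :
  uniq (s ++ [:: p, q, m & t]) -> R p m -> R m q ->
  chain R (s ++ [:: p, q, m & t]) k v ->
  chain R (s ++ [:: q, p, m & t]) k v \/
  v = q /\ chain R (s ++ [:: q, p, m & t]) k m.
Proof.
move=> uw pm mq; elim: k v => [|k ih] v /=.
  by left; move: H; rewrite !mem_cat !inE; case: (v == p); case: (v == q);
    rewrite ?orbT.
case=> u [Ruv uv /ih[h|[eu h]]].
  case: (boolP ((u == p) && (v == q))) => [/andP[/eqP eu /eqP ev]|nuv].
    right; split=> //; exists p; split=> //; last by move: h; rewrite {1}eu.
    by rewrite subseq2_cat !subseq2_cons !inE !eqxx; case: (p == q); rewrite !orbT.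
  by left; exists u; split=> //; apply: subseq2_swap uv.
left; exists m; split=> //; first by apply: R_trans mq _; rewrite -eu.
move: uv Ruv; rewrite eu -cat_rcons subseq2_pivotl ?cat_rcons // inE.
case/predU1P=> [->|vt] qv; first by have := R_irr m; rewrite (R_trans mq qv).
by rewrite subseq2_cat !subseq2_cons !inE vt eqxx !orbT; case: (m == q);
  case: (m == p); rewrite !orbT.
Qed.

Lemma chain_map w w' (g : nat -> nat) k v :
  subseq (map g w) w' -> {in w &, {mono g : x y / R x y}} ->
  chain R w k v -> chain R w' k (g v).
Proof.
move=> sub gm; elim: k v => [|k ih] v /=.
  by move=> vw; apply: (mem_subseq sub); apply: map_f.
case=> u [Ruv uv h]; have /andP[u_w v_w] := subseq2_mem uv.
exists (g u); split; [by rewrite gm | | exact: ih].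
exact: subseq_trans (map_subseq g uv) sub.
Qed.

Lemma chain_subseq w k v : uniq w -> chain R w k v ->
  exists A, [/\ size A = k, sorted R (rcons A v) & subseq (rcons A v) w].
Proof.
move=> uw; elim: k v => [|k ih] v /=.
  by exists [::]; rewrite /= sub1seq.
case=> u [Ruv uv /ih[A [sA stA subA]]]; exists (rcons A u); split.
- by rewrite size_rcons sA.
- by case: (A) stA => /= [|a A' stA]; rewrite ?Ruv // rcons_path stA last_rcons.
- have /andP[u_w _] := subseq2_mem uv.
  move: uw uv subA; case/splitPr: u_w => s t uw; rewrite subseq2_pivotl // => vt.
  rewrite -!cats1 -!catA !uniq_subseq_pivot // => /andP[-> _].
  by rewrite sub1seq.
Qed.

Lemma subseq_chain w A v : sorted R (rcons A v) -> subseq (rcons A v) w ->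
  chain R w (size A) v.
Proof.
elim/last_ind: A v => [|A u ih] v; first by rewrite /= sub1seq.
rewrite size_rcons => st sub; exists u; split.
- by case: (A) st => /= [|a A']; rewrite ?andbT // rcons_path last_rcons => /andP[].
- by apply: subseq_trans sub; rewrite -!cats1 -catA; apply: suffix_subseq.
- apply: ih; last by apply: subseq_trans sub; apply: subseq_rcons.
  by case: (A) st => //= a A'; rewrite rcons_path => /andP[].
Qed.

End Chain.

Lemma gtn_trans : transitive gtn.
Proof. by move=> x y z /= h h'; apply: ltn_trans h' h. Qed.

Lemma gtnn : irreflexive gtn.
Proof. exact: ltnn. Qed.

(** Both parameters leave out the common end, so the row hook of shape (a, 1^b) corresponds to
    [cross a.-1 b]. *)
Definition cross (a b : nat) (w : seq nat) :=
  exists v, chain ltn w a v /\ chain gtn w b v.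

(** A witness before the exchanged letters repairs a broken chain without changing the common end; a
    witness after them may have to become the common end. *)
Lemma cross_keq a b u v : keq u v -> uniq u -> (cross a b u <-> cross a b v).
Proof.
elim=> {u v} [//|u v h ih uv|u v w huv h1 _ h2 uu|u v x y z|u v x y z].
- by apply: iff_sym; apply: ih; rewrite (perm_uniq (keq_perm h)).
- apply: iff_trans (h1 uu) (h2 _); by rewrite -(perm_uniq (keq_perm huv)).
- move=> h uu; have uu' : uniq (u ++ [:: y, z, x & v]).
    by rewrite -(perm_uniq (keq_perm (keq_yxz u v h))).
  case/andP: h => xy yz; have xz := ltn_trans xy yz.
  split=> -[t [h1 h2]]; exists t; split.
  + exact: (chain_witness_before ltn_trans ltnn) h1.
  + move: h2; rewrite -cat_rcons -[u ++ [:: y, z & _]]cat_rcons.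
    by apply: chain_gain; rewrite /= -leqNgt ltnW.
  + move: h1; rewrite -cat_rcons -[u ++ [:: y, x & _]]cat_rcons.
    by apply: chain_gain; rewrite -leqNgt ltnW.
  + exact: (chain_witness_before gtn_trans gtnn) h2.
- move=> h uu; have uu' : uniq (u ++ [:: z, x, y & v]).
    by rewrite -(perm_uniq (keq_perm (keq_xzy u v h))).
  case/andP: h => xy yz; have xz := ltn_trans xy yz.
  split=> -[t [h1 h2]].
  + have h2' : chain gtn (u ++ [:: z, x, y & v]) b t.
      by apply: chain_gain h2; rewrite /= -leqNgt ltnW.
    case: (chain_witness_after ltn_trans ltnn uu xy yz h1) => [h|[e h]].
      by exists t.
    (* The common end was [z], and its increasing chain now ends at [y]. Since [y] is smaller than
       [z] and stands after it, [y] also replaces [z] at the end of the decreasing chain. *)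
    exists y; split=> //; apply: (chain_extend (u := z) gtn_trans uu') => //.
      by rewrite -{2}e.
    by rewrite subseq2_pivotl // !inE eqxx orbT.
  + have h1' : chain ltn (u ++ [:: x, z, y & v]) a t.
      by apply: chain_gain h1; rewrite /= -leqNgt ltnW.
    case: (chain_witness_after gtn_trans gtnn uu' yz xy h2) => [h|[e h]].
      by exists t.
    exists y; split=> //; apply: (chain_extend (u := x) ltn_trans uu) => //.
      by rewrite -{2}e.
    by rewrite subseq2_pivotl // !inE eqxx orbT.
Qed.

Lemma cross_contains a b sigma pi :
  uniq pi -> contains sigma pi -> cross a b pi -> cross a b sigma.
Proof.
move=> up /(contains_embedding up)[g sub gm] [v [h1 h2]].
by exists (g v); split; [apply: chain_map h1 | apply: chain_map h2 => // x y xp yp;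
  apply: gm].
Qed.

(** * Superstandard hooks are closed *)

Definition hook_tableau (row col : seq nat) : tableau :=
  row :: [seq [:: c] | c <- col].

Lemma row_insert_column b col :
  sorted ltn (b :: col) ->
  row_insert [seq [:: c] | c <- col] b = [seq [:: c] | c <- b :: col].
Proof.
elim: col b => //= c col ih b /andP[bc sc].
by rewrite bc /= ih.
Qed.

Lemma row_insert_end A T x :
  all (gtn x) A -> row_insert (A :: T) x = rcons A x :: T.
Proof.
move=> Ax; apply/row_insert_append/hasNfind; rewrite -all_predC.
by apply: sub_all Ax => y /= yx; rewrite -leqNgt ltnW.
Qed.

Lemma row_insert_bump_last A b T x : all (gtn x) A -> x < b ->
  row_insert (rcons A b :: T) x = rcons A x :: row_insert T b.
Proof.
move=> Ax xb; rewrite -!cats1; apply: (@row_insert_split _ T x A b [::]) => //.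
rewrite find_cat /= xb addn0; case: ifP => // /hasP[y /(allP Ax)] /= yx.
by rewrite ltnNge ltnW.
Qed.

Lemma sorted_gtn_rcons B x : sorted gtn (rcons B x) = all (ltn x) B && sorted gtn B.
Proof. by rewrite -rev_ltn rev_rcons sorted_ltn_cons all_rev rev_ltn. Qed.

Lemma sorted_ltn_rconsE A x : sorted ltn (rcons A x) = all (gtn x) A && sorted ltn A.
Proof. by rewrite -cats1 sorted_ltn_cat /= andbT allrel1r. Qed.

(** At most one large letter [b] waits at the end of the first row. A new small letter bumps it into
    the column, and a new large letter, being smaller than [b], bumps it and waits in turn. Starting
    from one empty row makes the empty word a hook too. *)
Lemma insert_shuffle (w : seq nat) (v : nat) :
  v \notin w -> sorted ltn (filter (gtn v) w) -> sorted gtn (filter (ltn v) w) ->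
  let A := filter (gtn v) w in let B := filter (ltn v) w in
  foldl row_insert [:: [::]] w = hook_tableau A (rev B) \/
  exists b B', B = rcons B' b /\
    foldl row_insert [:: [::]] w = hook_tableau (rcons A b) (rev B').
Proof.
elim/last_ind: w => [|w x ih]; first by left.
rewrite mem_rcons inE negb_or => /andP[vx vw].
rewrite !filter_rcons /= -!cats1 foldl_cat /= !cats1.
have Asub y : y \in filter (gtn v) w -> y < v by rewrite mem_filter => /andP[].
case: (ltngtP v x) vx => // [vx|xv] _.
  move=> sA; rewrite sorted_gtn_rcons => /andP[xB sB]; right.
  exists x, (filter (ltn v) w); split=> //.
  have xA : all (gtn x) (filter (gtn v) w).
    by apply/allP => y /Asub /= yv; apply: ltn_trans vx.
  case: (ih vw sA sB) => [->|[b [B' [eB ->]]]]; first by rewrite row_insert_end.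
  move: xB sB; rewrite eB all_rcons => /andP[xb _]; rewrite -rev_ltn rev_rcons => sB.
  by rewrite row_insert_bump_last // row_insert_column.
rewrite sorted_ltn_rconsE => /andP[xA sA] sB; left.
case: (ih vw sA sB) => [->|[b [B' [eB ->]]]]; first by rewrite row_insert_end.
have xb : x < b.
  have : b \in filter (ltn v) w by rewrite eB mem_rcons inE eqxx.
  by rewrite mem_filter => /andP[/= vb _]; apply: ltn_trans vb.
move: sB; rewrite eB -rev_ltn rev_rcons => sB.
by rewrite row_insert_bump_last // row_insert_column.
Qed.

Lemma insertion_shuffle (w : seq nat) (v : nat) :
  v \notin w -> sorted ltn (filter (gtn v) w) -> sorted gtn (filter (ltn v) w) ->
  insertion_tableau (rcons w v) =
    hook_tableau (rcons (filter (gtn v) w) v) (rev (filter (ltn v) w)).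
Proof.
move=> vw sA sB; have Av : all (gtn v) (filter (gtn v) w) by apply: filter_all.
rewrite /insertion_tableau foldl_row_insert_nil; last by case: (w).
rewrite -cats1 foldl_cat /=.
case: (insert_shuffle vw sA sB) => [->|[b [B' [eB ->]]]];
  first by rewrite row_insert_end.
have vb : v < b.
  have : b \in filter (ltn v) w by rewrite eB mem_rcons inE eqxx.
  by rewrite mem_filter => /andP[].
move: sB; rewrite eB -rev_ltn rev_rcons => sB.
by rewrite row_insert_bump_last // row_insert_column.
Qed.

(** With [v] read first, the corner holds the latest small letter, which has pushed its predecessors
    down the column; large letters are appended to the row. *)
Lemma insertion_shuffle_cons (w : seq nat) (v : nat) :
  v \notin w -> sorted gtn (filter (gtn v) w) -> sorted ltn (filter (ltn v) w) ->
  let A := filter (gtn v) w in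
  insertion_tableau (v :: w) =
    hook_tableau (last v A :: filter (ltn v) w) (rev (belast v A)).
Proof.
elim/last_ind: w => [//|w x ih].
rewrite mem_rcons inE negb_or => /andP[vx vw]; rewrite -rcons_cons.
rewrite insertion_tableau_rcons !filter_rcons /=.
case: (ltngtP v x) vx => // [vx|xv] _.
  move=> sA; rewrite sorted_ltn_rconsE => /andP[xB sB].
  rewrite ih // row_insert_end //= xB andbT.
  have : last v (filter (gtn v) w) \in v :: filter (gtn v) w by apply: mem_last.
  rewrite inE mem_filter => /predU1P[->//|/andP[/= lv _]]; exact: ltn_trans vx.
rewrite sorted_gtn_rcons => /andP[xA sA] sB; rewrite ih //.
have sl : sorted gtn (v :: filter (gtn v) w).
  by rewrite /= path_sortedE ?sA ?filter_all //; apply: gtn_trans.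
have xl : x < last v (filter (gtn v) w).
  have : last v (filter (gtn v) w) \in v :: filter (gtn v) w by apply: mem_last.
  by rewrite inE => /predU1P[->//|/(allP xA)].
rewrite (@row_insert_split _ _ _ [::] (last v (filter (gtn v) w)) (filter (ltn v) w))
  //=; last by rewrite xl.
rewrite row_insert_column.
  by rewrite last_rcons belast_rcons -rev_rcons -lastI.
by rewrite -rev_rcons -lastI rev_ltn.
Qed.

(** * Standardisation, and closure from an invariant *)

Lemma sorted_iota_split p q n : sorted ltn (p ++ q) -> perm_eq (p ++ q) (iota 1 n) ->
  p = iota 1 (size p) /\ q = iota (size p).+1 (size q).
Proof.
move=> s pe; have e : p ++ q = iota 1 n.
  apply: (irr_sorted_eq ltn_trans ltnn s (iota_ltn_sorted 1 n)).
  exact: perm_mem pe.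
have en : n = size p + size q by rewrite -(size_iota 1 n) -e size_cat.
move: e; rewrite en iotaD add1n => /eqP; rewrite eqseq_cat ?size_iota //.
by case/andP=> /eqP -> /eqP ->; rewrite !size_iota.
Qed.

Definition rank (s : seq nat) (x : nat) := (count (gtn x) s).+1.

Lemma rank_mono s : {in s &, {mono rank s : x y / x < y}}.
Proof.
have mono x y : x \in s -> x < y -> rank s x < rank s y.
  move=> xs xy; rewrite /rank ltnS; elim: s xs => //= z s ih.
  have le : count (gtn x) s <= count (gtn y) s.
    by apply: sub_count => t /= tx; apply: ltn_trans xy.
  rewrite inE => /predU1P[<-|/ih h]; first by rewrite xy ltnn; lia.
  by case: (ltnP z x) => zx; case: (ltnP z y) => zy; lia.
move=> x y xs ys; case: (ltngtP x y) => [xy|yx|->]; last by rewrite ltnn.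
  exact: mono.
by apply/negbTE; rewrite -leqNgt ltnW // mono.
Qed.

Lemma ltn_mono_inj_in (f : nat -> nat) (s : seq nat) :
  {in s &, {mono f : x y / x < y}} -> {in s &, injective f}.
Proof.
move=> fm x y xs ys e; have := fm x y xs ys; have := fm y x ys xs.
by rewrite e ltnn; case: ltngtP.
Qed.

Lemma is_permutation_rank s : uniq s -> is_permutation (map (rank s) s).
Proof.
move=> us; rewrite /is_permutation /is_permutation_of size_map.
have ur : uniq (map (rank s) s) by rewrite map_inj_in_uniq //;
  apply/ltn_mono_inj_in/rank_mono.
have sub : {subset map (rank s) s <= iota 1 (size s)}.
  move=> _ /mapP[x xs ->]; rewrite mem_iota /rank add1n ltnS /=.
  rewrite -(count_predC (gtn x) s) -addn1 leq_add2l -has_count.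
  by apply/hasP; exists x; rewrite //= ltnn.
have [|_ h] := uniq_min_size ur sub; first by rewrite size_iota size_map.
exact: uniq_perm (iota_uniq _ _) h.
Qed.

(** Two words with the same insertion tableau are equivalent to its reading word, so [G], and with
    it containment of a pattern from the class, agrees on them. The union is taken over the tableaux
    of the avoiding permutations. *)
Lemma closed_of_invariant P (G : seq nat -> Prop) :
  tab P ->
  (forall u v, keq u v -> uniq u -> G u -> G v) ->
  (forall sigma, uniq sigma ->
     G sigma <-> exists2 pi, knuth_class P pi & contains sigma pi) ->
  pattern_knuth_closed (knuth_class P).
Proof.
move=> tP Gkeq GP n.
exists (fun T => is_syt T /\ exists2 sigma,
  avoidance_class n (knuth_class P) sigma & insertion_tableau sigma = T).
split=> [T []//|sigma]; split=> [As|[T [_ [tau [pt av] eT]] [ps eS]]].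
  have ps := is_permutation_of_size As.1.
  exists (insertion_tableau sigma); last by split.
  by split; [apply: syt_insertion_tableau | exists sigma].
have us := is_permutation_uniq ps; have ut := is_permutation_uniq pt.
have st : keq sigma tau.
  apply: keq_trans (keq_insertion_tableau us) _; rewrite eS -eT.
  exact/keq_sym/keq_insertion_tableau.
split; first by apply: is_permutation_keq pt; apply: keq_sym.
move=> pi Kpi sp; have /(GP _ us)/(Gkeq _ _ st us)/(GP _ ut)[pi' Kpi' tp] :
  exists2 pi, knuth_class P pi & contains sigma pi by exists pi.
exact: av Kpi' tp.
Qed.

(** * The crossing invariant for row and column hooks *)

Definition row_hook a b := hook_tableau (iota 1 a) (iota a.+1 b).
Definition column_hook a b := hook_tableau (1 :: iota b.+2 a.-1) (iota 2 b).

Lemma reading_word_hook row col :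
  reading_word (hook_tableau row col) = rev col ++ row.
Proof.
rewrite reading_word_cons; congr (_ ++ _); rewrite /reading_word -map_rev.
by elim: (rev col) => //= c s ->.
Qed.

Lemma iota_rcons m n : iota m n.+1 = rcons (iota m n) (m + n).
Proof. by rewrite -addn1 iotaD cats1. Qed.

Lemma cross_hook_word a b :
  0 < a -> cross a.-1 b (rev (iota a.+1 b) ++ iota 1 a).
Proof.
case: a => // a _; exists a.+1; rewrite iota_rcons add1n; split.
  have := @subseq_chain ltn _ (iota 1 a) a.+1 _ (suffix_subseq _ _).
  rewrite size_iota; apply.
  by rewrite -add1n -iota_rcons iota_ltn_sorted.
have := @subseq_chain gtn _ (rev (iota a.+2 b)) a.+1.
rewrite size_rev size_iota; apply.
  by rewrite -rev_cons rev_gtn; apply: (iota_ltn_sorted a.+1 b.+1).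
by rewrite -!cats1 catA; apply: cat_subseq => //; apply: prefix_subseq.
Qed.

(** Keep, before the common end [v], only the letters of the two chains. One chain lies below [v]
    and the other above, so comparison with [v] separates them again. *)
Lemma cross_shuffle a b w : uniq w -> cross a b w ->
  exists w' v, [/\ subseq (rcons w' v) w, v \notin w',
    size (filter (gtn v) w') = a /\ size (filter (ltn v) w') = b,
    sorted ltn (filter (gtn v) w') & sorted gtn (filter (ltn v) w')].
Proof.
move=> uw [v [/(chain_subseq uw)[A [sA stA subA]] /(chain_subseq uw)[B [sB stB subB]]]].
have vw : v \in w by apply: (mem_subseq subA); rewrite mem_rcons inE eqxx.
move: uw subA subB; case/splitPr: vw => s t uw.
rewrite -!cats1 !uniq_subseq_pivot // !sub0seq !andbT => subA subB.
have us : uniq s by move: uw; rewrite cat_uniq => /and3P[].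
have vs : v \notin s.
  by move: uw; rewrite cat_uniq /= negb_or => /and3P[_ /andP[]].
move: stA stB; rewrite sorted_ltn_rconsE sorted_gtn_rcons.
move=> /andP[Av stA] /andP[Bv stB].
pose w' := filter (mem (A ++ B)) s.
have eA : filter (gtn v) w' = A.
  rewrite -filter_predI; apply/esym; move/(subseq_uniqP us): (subA) => {1}->.
  apply: eq_in_filter => x _ /=; rewrite mem_cat; case: (boolP (x \in A)) => xA /=.
    by have /= -> := allP Av _ xA.
  case: (boolP (x \in B)) => xB; rewrite ?andbF // ltnNge.
  by have /= /ltnW -> := allP Bv _ xB.
have eB : filter (ltn v) w' = B.
  rewrite -filter_predI; apply/esym; move/(subseq_uniqP us): (subB) => {1}->.
  apply: eq_in_filter => x _ /=; rewrite mem_cat orbC.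
  case: (boolP (x \in B)) => xB /=; first by have /= -> := allP Bv _ xB.
  case: (boolP (x \in A)) => xA; rewrite ?andbF // ltnNge.
  by have /= /ltnW -> := allP Av _ xA.
exists w', v; rewrite eA eB; split=> //.
  rewrite -cat_rcons -!cats1; apply: subseq_trans (prefix_subseq _ _).
  by apply: cat_subseq => //; apply: filter_subseq.
by apply: contra vs; rewrite mem_filter => /andP[].
Qed.

Lemma filter_map_mono (f : nat -> nat) (s : seq nat) v :
  {in v :: s &, {mono f : x y / x < y}} ->
  filter (gtn (f v)) (map f s) = map f (filter (gtn v) s) /\
  filter (ltn (f v)) (map f s) = map f (filter (ltn v) s).
Proof.
move=> fm; rewrite !filter_map; split; congr map; apply: eq_in_filter => x xs /=;
  by rewrite fm // inE ?eqxx ?xs ?orbT.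
Qed.

Lemma perm_filter_cut v (w : seq nat) : v \notin w ->
  perm_eq (rcons (filter (gtn v) w) v ++ rev (filter (ltn v) w)) (rcons w v).
Proof.
move=> vw; apply/permP => p; rewrite -!cats1 !count_cat count_rev addnAC.
congr (_ + _); have /permP/(_ p) <- := permEl (perm_filterC (gtn v) w).
rewrite count_cat; congr (_ + count p _); apply: eq_in_filter => x xw /=.
rewrite -leqNgt ltn_neqAle (_ : v != x) //; by apply: contraNneq vw => ->.
Qed.

(** In a permutation the letters up to [v] form an initial segment, so the sizes of the two parts
    determine them. *)
Lemma cut_iota w v : v \notin w -> is_permutation (rcons w v) ->
  forall A B, perm_eq A (filter (gtn v) w) -> perm_eq B (filter (ltn v) w) ->
  sorted ltn A -> sorted ltn B ->
  rcons A v = iota 1 (size A).+1 /\ B = iota (size A).+2 (size B).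
Proof.
move=> vw pw A B pA pB sA sB.
have Av : all (gtn v) A by rewrite (perm_all _ pA) filter_all.
have Bv : all (ltn v) B by rewrite (perm_all _ pB) filter_all.
have st : sorted ltn (rcons A v ++ B).
  rewrite cat_rcons sorted_ltn_cat sorted_ltn_cons Bv sB sA !andbT.
  rewrite allrel_consr Av /=; apply/allrelP => x y /(allP Av) /= xv /(allP Bv) /=.
  exact: ltn_trans.
have := sorted_iota_split st; rewrite size_rcons; apply.
apply: perm_trans pw; rewrite -(permPr (perm_filter_cut vw)) -!cats1.
by rewrite !perm_cat // perm_sym perm_rev perm_sym.
Qed.

Lemma insertion_standard_shuffle w v : v \notin w -> is_permutation (rcons w v) ->
  sorted ltn (filter (gtn v) w) -> sorted gtn (filter (ltn v) w) ->
  insertion_tableau (rcons w v) =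
    row_hook (size (filter (gtn v) w)).+1 (size (filter (ltn v) w)).
Proof.
move=> vw pw sA sB; rewrite insertion_shuffle // /row_hook.
have [||| |-> eB] := cut_iota vw pw (A := filter (gtn v) w)
  (B := rev (filter (ltn v) w)) => //; first by rewrite perm_rev.
  by rewrite rev_ltn.
by rewrite {1}eB size_rev.
Qed.

Lemma insertion_standard_shuffle_cons w v :
  v \notin w -> is_permutation (v :: w) ->
  sorted gtn (filter (gtn v) w) -> sorted ltn (filter (ltn v) w) ->
  insertion_tableau (v :: w) =
    column_hook (size (filter (ltn v) w)).+1 (size (filter (gtn v) w)).
Proof.
move=> vw pw sA sB; rewrite insertion_shuffle_cons // /column_hook.
have pw' : is_permutation (rcons w v).
  rewrite /is_permutation size_rcons; apply: perm_trans pw.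
  by rewrite perm_rcons.
have [||| |eA eB] := cut_iota vw pw' (A := rev (filter (gtn v) w))
  (B := filter (ltn v) w) => //; first by rewrite perm_rev.
  by rewrite rev_ltn.
move: eA; rewrite -rev_cons lastI rev_rcons size_rev => -[-> ->].
by rewrite {1}eB size_rev.
Qed.

(** From a crossing, the standardised shuffle is a pattern whose insertion tableau is the row hook.
    Conversely, the reading word has a crossing at the last entry of its first row, and [keq]
    carries this to the whole class. *)
Lemma cross_row_hook a b sigma : 0 < a -> tab (row_hook a b) -> uniq sigma ->
  cross a.-1 b sigma <->
  exists2 pi, knuth_class (row_hook a b) pi & contains sigma pi.
Proof.
move=> a0 tP us; split=> [|[pi Kpi sp]]; last first.
  have up := is_permutation_uniq Kpi.1; apply: (cross_contains up sp).
  apply/(cross_keq _ _ (knuth_class_keq tP Kpi) up).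
  by rewrite reading_word_hook; apply: cross_hook_word.
case/(cross_shuffle us)=> w' [v [sub vw [sA sB] stA stB]].
have rm := @rank_mono (rcons w' v); have uw := subseq_uniq sub us.
exists (map (rank (rcons w' v)) (rcons w' v)); last first.
  by exists (rcons w' v) => //; apply: map_order_isomorphic.
have := is_permutation_rank uw; set r := rank _ => pr; split=> //.
have rm' : {in v :: w' &, {mono r : x y / x < y}}.
  by move=> x y xw yw; apply: rm; rewrite mem_rcons.
have [eA eB] := filter_map_mono rm'.
rewrite map_rcons in pr *; rewrite insertion_standard_shuffle //.
- by rewrite eA eB !size_map sA sB prednK.
- by move: (is_permutation_uniq pr); rewrite rcons_uniq => /andP[].
- rewrite eA (sorted_map_mono rm' _).1 //; apply/allP => x.
  by rewrite mem_filter => /andP[_ xw]; apply/orP; right.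
- rewrite eB (sorted_map_mono rm' _).2 //; apply/allP => x.
  by rewrite mem_filter => /andP[_ xw]; apply/orP; right.
Qed.

Lemma cross_column_hook a b sigma : 0 < a -> tab (column_hook a b) -> uniq sigma ->
  cross b a.-1 (rev sigma) <->
  exists2 pi, knuth_class (column_hook a b) pi & contains sigma pi.
Proof.
move=> a0 tP us; split=> [|[pi Kpi sp]]; last first.
  have up := is_permutation_uniq Kpi.1.
  have upr : uniq (rev pi) by rewrite rev_uniq.
  apply: (cross_contains upr (contains_rev up sp)).
  apply/(cross_keq _ _ (keq_rev (knuth_class_keq tP Kpi)) upr).
  rewrite reading_word_hook rev_cat revK rev_cons cat_rcons.
  (* The reversed reading word is that of the row hook of conjugate shape (b+1, 1^(a-1)). *)
  exact: (@cross_hook_word b.+1).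
have usr : uniq (rev sigma) by rewrite rev_uniq.
case/(cross_shuffle usr)=> w' [v [sub vw [sA sB] stA stB]].
have {}sub : subseq (v :: rev w') sigma by rewrite -rev_rcons -[sigma]revK subseq_rev.
have rm := @rank_mono (v :: rev w'); have uw := subseq_uniq sub us.
exists (map (rank (v :: rev w')) (v :: rev w')); last first.
  by exists (v :: rev w') => //; apply: map_order_isomorphic.
have := is_permutation_rank uw; set r := rank _ => pr; split=> //.
have [eA eB] := filter_map_mono rm.
rewrite /= in pr *; rewrite insertion_standard_shuffle_cons //.
- by rewrite eA eB !size_map !filter_rev !size_rev sA sB prednK.
- by move: (is_permutation_uniq pr) => /= /andP[].
- rewrite eA (sorted_map_mono rm _).2 ?filter_rev ?rev_gtn //; apply/allP => x.
  rewrite mem_rev mem_filter => /andP[_ xw].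
  by suff : x \in v :: rev w' by []; rewrite inE mem_rev xw orbT.
- rewrite eB (sorted_map_mono rm _).1 ?filter_rev ?rev_ltn //; apply/allP => x.
  rewrite mem_rev mem_filter => /andP[_ xw].
  by suff : x \in v :: rev w' by []; rewrite inE mem_rev xw orbT.
Qed.

Lemma row_hook_closed a b : 0 < a -> tab (row_hook a b) ->
  pattern_knuth_closed (knuth_class (row_hook a b)).
Proof.
move=> a0 tP; apply: (closed_of_invariant (G := cross a.-1 b)) => //.
  by move=> u v uv /(cross_keq a.-1 b uv)[].
by move=> sigma; apply: cross_row_hook.
Qed.

Lemma column_hook_closed a b : 0 < a -> tab (column_hook a b) ->
  pattern_knuth_closed (knuth_class (column_hook a b)).
Proof.
move=> a0 tP; apply: (closed_of_invariant (G := fun w => cross b a.-1 (rev w))) => //.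
  move=> u v /keq_rev uv uu; have urr : uniq (rev u) by rewrite rev_uniq.
  by case: (cross_keq b a.-1 uv urr).
by move=> sigma; apply: cross_column_hook.
Qed.

(** * Superstandard tableaux of hook shape in explicit form *)

Lemma sumn_nseq1 b : sumn (nseq b 1) = b.
Proof. by rewrite sumn_nseq mul1n. Qed.

Lemma row_superstandard_hook a b :
  row_superstandard (a :: nseq b 1) = row_hook a b.
Proof.
rewrite /row_superstandard /= sumn_nseq1 iotaD take_size_cat ?size_iota //.
rewrite drop_size_cat ?size_iota // add1n; congr (_ :: _).
by elim: b a.+1 => //= b ih m; rewrite take0 drop0 ih.
Qed.

Lemma column_superstandard_hook a b : 0 < a ->
  column_superstandard (a :: nseq b 1) = column_hook a b.
Proof.
case: a => // a _; rewrite /column_superstandard /column_hook /= size_nseq.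
have col0 : column_length (a.+1 :: nseq b 1) 0 = b.+1.
  by rewrite /column_length /= count_nseq mul1n.
have col j : 0 < j < a.+1 -> column_length (a.+1 :: nseq b 1) j = 1.
  by rewrite /column_length /= count_nseq => /andP[]; case: j => // j _ ->.
have sumcol j : j <= a ->
    sumn (mkseq (column_length (a.+1 :: nseq b 1)) j.+1) = b.+1 + j.
  elim: j => [_|j ih ja]; first by rewrite -[b.+1]col0.
  by rewrite mkseqS sumn_rcons ih ?col //; lia.
rewrite /hook_tableau /mkseq -[iota 0 b.+1]/(0 :: iota 1 b) map_cons.
congr (_ :: _).
  apply: (@eq_from_nth _ 0) => [|i]; first by rewrite size_map !size_iota /= size_iota.
  rewrite size_map size_iota [nth 0 (_ :: _) 0]/= => ia;
    rewrite (nth_map 0) ?size_iota // nth_iota //.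
  case: i ia => [//|i] ia; rewrite add0n sumcol 1?ltnW // [RHS]/= nth_iota //.
  by rewrite addn1 !addSn.
rewrite -[2]/(1 + 1) iotaDl -map_comp; apply/eq_in_map => i.
rewrite mem_iota => /andP[i0 ib]; have -> : nth 0 (a.+1 :: nseq b 1) i = 1.
  by case: i i0 ib => //= i _ ib; rewrite nth_nseq ifT.
by [].
Qed.

(** * Hooks that are not superstandard *)

(** The letters exchanged by a move have another letter strictly between them in value, so they are
    never consecutive numbers. *)
Lemma keq_descent u v p : keq u v ->
  subseq [:: p.+1; p] u = subseq [:: p.+1; p] v.
Proof.
elim=> {u v} [//|u v _ -> //|u v w _ -> _ -> //|u v x y z h|u v x y z h].
  rewrite -(cat_rcons y u [:: x, z & v]) -(cat_rcons y u [:: z, x & v]).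
  by apply/idP/idP; apply: subseq2_swap; lia.
by apply/idP/idP; apply: subseq2_swap; lia.
Qed.

Lemma subseq2_cat_disjoint p q (u v : seq nat) :
  uniq (u ++ v) -> p \in v -> q \in u -> subseq [:: p; q] (u ++ v) = false.
Proof.
rewrite cat_uniq => /and3P[_ /hasPn h _] pv qu; rewrite subseq2_cat.
have pu : p \in u = false by apply/negbTE/h.
have qv : q \in v = false by apply/negbTE/negP => /h; rewrite qu.
rewrite pu /=; apply/norP; split; apply/negP => /subseq2_mem/andP[].
  by rewrite pu.
by rewrite qv.
Qed.

Lemma sorted_split y X : sorted ltn X ->
  X = filter (gtn y) X ++ filter (leq y) X.
Proof.
elim: X => //= x X ih sX; case: (ltnP x y) => xy;
  first by rewrite /= -ih // (path_sorted sX).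
have yX : all (leq y) (x :: X).
  rewrite /= xy; apply: sub_all (order_path_min ltn_trans sX) => z /= xz.
  exact: leq_trans xy (ltnW xz).
rewrite (_ : filter (gtn y) X = [::]) /=;
  first by move: yX => /= /andP[_ /all_filterP ->].
apply/eqP; rewrite -(negbK (_ == _)) -has_filter -all_predC.
by apply: sub_all (andP yX).2 => z /=; rewrite -leqNgt.
Qed.

Definition shift m v := if v <= m then v else v.+1.

Lemma shift_mono m : {mono shift m : x y / x < y}.
Proof. by move=> x y; rewrite /shift; case: ifP; case: ifP; lia. Qed.

Lemma perm_shift m n : m <= n ->
  perm_eq (m.+1 :: map (shift m) (iota 1 n)) (iota 1 n.+1).
Proof.
move=> mn; rewrite -(subnKC mn); set k := n - m.
rewrite iotaD map_cat add1n -addnS iotaD add1n /=.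
have -> : map (shift m) (iota 1 m) = iota 1 m.
  apply: map_id_in => v; rewrite mem_iota /shift => h; rewrite ifT //; lia.
have -> : map (shift m) (iota m.+1 k) = iota m.+2 k.
  rewrite -[m.+2]add1n iotaDl; apply/eq_in_map => v; rewrite mem_iota /shift => h.
  by rewrite ifF //; lia.
by rewrite (perm_catCA [:: m.+1]).
Qed.

(** An increasing map from n letters to n+1 letters misses exactly one value. *)
Lemma embedding_bounds n (g : nat -> nat) :
  (forall v, 0 < v <= n -> 0 < g v <= n.+1) ->
  (forall v, 0 < v -> v < n -> g v < g v.+1) ->
  forall v, 0 < v <= n -> v <= g v <= v.+1.
Proof.
move=> gmem gS.
have glow v : 0 < v <= n -> v <= g v.
  elim: v => // v ih h; case: (posnP v) => [->|v0]; first by have := gmem 1; lia.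
  by have := gS v v0; lia.
have gtop k : k < n -> g (n - k) <= (n - k).+1.
  elim: k => [|k ih] kn; first by rewrite subn0; have := gmem n; lia.
  have := gS (n - k.+1); have -> : (n - k.+1).+1 = n - k by lia.
  by lia.
move=> v h; rewrite glow //=.
by have := gtop (n - v); rewrite subKn; lia.
Qed.

(** In the application [before] is precedence in [tau]: the letters m+2, ..., j stand in decreasing
    order, and no letter up to m+1 precedes any of m+2, ..., j+1. An ascent from m+2, ..., j to j+1
    is still possible, so two consecutive ascents are needed for a contradiction. *)
Lemma embedding_window n m j (g : nat -> nat) (before : rel nat) p q r :
  (forall v, 0 < v <= n -> v <= g v <= v.+1) ->
  (forall v, m < v <= n -> g v = v.+1) ->
  (forall u v, m.+1 < u -> u < v <= j -> ~~ before u v) ->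
  (forall l u, 0 < l <= m.+1 -> m.+1 < u <= j.+1 -> ~~ before l u) ->
  1 < m -> j <= n -> m.-1 <= p -> p < q < r -> r <= j ->
  before (g p) (g q) -> before (g q) (g r) -> False.
Proof.
move=> gb gh F1 F2 m1 jn mp /andP[pq qr] rj bpq bqr.
have gr : g r = r.+1 by apply: gh; lia.
case: (leqP q m) => qm.
  have gq : q <= g q <= q.+1 by apply: gb; lia.
  by move: bqr; apply/negP/F2; lia.
have gq : g q = q.+1 by apply: gh; lia.
case: (leqP p m) => pm; last first.
  have gp : g p = p.+1 by apply: gh; lia.
  by move: bpq; apply/negP/F1; lia.
have gp : p <= g p <= p.+1 by apply: gb; lia.
by move: bpq; apply/negP/F2; lia.
Qed.

Lemma subseq_initial m j (s : seq nat) :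
  1 < m -> subseq [:: m.-1; m; j] (iota 1 m ++ j :: s).
Proof.
case: m => [//|[//|k]] _; rewrite !iota_rcons -!cats1 -!catA add1n.
by apply: subseq_trans (suffix_subseq _ _); rewrite /= !eqxx sub0seq.
Qed.

(** [X] and [Y] are the first row and the column below it or, for reversed words, the first column
    and the rest of the row. Shifting the letters above m frees m+1 and turns j into j+1; the new
    letter m+1 is the witness that lets j+1 hop left over 1, ..., m. *)
Lemma hook_word_obstruction n m j Xb Y :
  1 < m -> m.+1 < j -> let X := iota 1 m ++ j :: Xb in
  sorted ltn X -> sorted ltn Y -> perm_eq (X ++ Y) (iota 1 n) ->
  (forall v, m < v < j -> v \in Y) ->
  exists sigma tau,
    [/\ is_permutation_of n.+1 sigma, keq sigma tau, contains sigma (rev Y ++ X)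
      & forall pi, is_permutation_of n pi -> keq pi (rev Y ++ X) -> avoids tau pi].
Proof.
move=> m1 mj X sX sY pXY midY; set D := rev (map (shift m) Y).
have jn : 0 < j <= n.
  have : j \in X ++ Y by rewrite !mem_cat inE eqxx !orbT.
  by rewrite (perm_mem pXY) mem_iota add1n.
pose E := iota 1 m ++ m.+1 :: map (shift m) Xb.
pose sigma := D ++ iota 1 m ++ [:: j.+1, m.+1 & map (shift m) Xb].
pose tau := D ++ j.+1 :: E.
have st : keq sigma tau.
  have srt : sorted ltn (rcons (iota 1 m) m.+1).
    by rewrite -[m.+1]add1n -iota_rcons iota_ltn_sorted.
  have mj1 : m.+1 < j.+1 by apply: ltnW.
  have := keq_catr (map (shift m) Xb) (keq_inc_hop mj1 srt).
  by rewrite -catA /= cat_rcons => /(keq_catl D).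
have sj : shift m j = j.+1 by rewrite /shift ifF //; lia.
have siota : map (shift m) (iota 1 m) = iota 1 m.
  apply: map_id_in => v; rewrite mem_iota /shift => h; rewrite ifT //; lia.
have ps : is_permutation_of n.+1 sigma.
  apply: perm_trans (perm_shift (_ : m <= n)); last lia.
  have := perm_map (shift m) pXY; rewrite perm_sym => /permP eqc.
  apply/permP => p; rewrite /= eqc !map_cat /= siota sj.
  rewrite /sigma /D !count_cat count_rev /=; lia.
exists sigma, tau; split=> //.
  apply: (contains_map (g := shift m)) => [|x y _ _]; last exact: shift_mono.
  rewrite map_cat map_rev; apply: cat_subseq => //.
  rewrite map_cat siota /= sj; apply: cat_subseq => //=; rewrite eqxx.
  exact: subseq_cons.
have pt := is_permutation_keq st ps; have ut := is_permutation_uniq pt.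
have Dmid u : m.+1 < u <= j -> u \in D.
  move=> h; rewrite mem_rev; apply/mapP; exists u.-1; first by apply: midY; lia.
  by rewrite /shift ifF; lia.
have sD : sorted gtn D.
  rewrite rev_gtn; rewrite (sorted_map_mono (P := predT) _ _).1 ?all_predT //.
  by move=> x y _ _; apply: shift_mono.
have F1 u v : m.+1 < u -> u < v <= j -> ~~ subseq [:: u; v] tau.
  move=> hu hv; have uD : u \in D by apply: Dmid; lia.
  have vD : v \in D by apply: Dmid; lia.
  rewrite /tau subseq2_cat; move: ut; rewrite cat_uniq => /and3P[_ /hasPn hD _].
  apply/or3P => -[].
  - by move/(subseq_sorted gtn_trans)/(_ sD); rewrite /= andbT ltnNge ltnW //;
    case/andP: hv.
  - by case/andP=> _ /hD; rewrite vD.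
  - by case/subseq2_mem/andP=> /hD; rewrite uD.
have tauE : tau = rcons D j.+1 ++ E by rewrite cat_rcons.
have F2 l u : 0 < l <= m.+1 -> m.+1 < u <= j.+1 -> ~~ subseq [:: l; u] tau.
  move=> hl hu; move: ut; rewrite tauE => /subseq2_cat_disjoint -> //.
    rewrite mem_cat inE mem_iota; lia.
  rewrite mem_rcons inE; case: eqP => //= ne; apply: Dmid; lia.
have F3 : ~~ subseq [:: m.+1; m] tau.
  move: ut; rewrite tauE /E catA => /subseq2_cat_disjoint -> //.
    by rewrite inE eqxx.
  by rewrite mem_cat mem_iota; lia.
move=> pi pp kp /(contains_embedding (is_permutation_uniq pp))[g sub gm].
have mpi v : (v \in pi) = (0 < v <= n) by apply: mem_is_permutation.
have gmem v : 0 < v <= n -> 0 < g v <= n.+1.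
  move=> h; rewrite -(mem_is_permutation _ pt); apply: (mem_subseq sub).
  by apply: map_f; rewrite mpi.
have gS v : 0 < v -> v < n -> g v < g v.+1 by move=> v0 vn;
  rewrite gm ?mpi ?v0 //= ltnW.
have gb := embedding_bounds gmem gS.
have gsub u v : subseq [:: u; v] pi -> subseq [:: g u; g v] tau.
  by move=> uv; apply: subseq_trans (map_subseq g uv) sub.
have desc : subseq [:: m.+1; m] pi.
  rewrite (keq_descent _ kp) subseq2_cat mem_rev midY ?ltnSn //.
  by rewrite mem_cat mem_iota add1n ltnS leqnn (ltnW m1) !orbT.
have mn : m < n by clear - jn mj; lia.
(* Otherwise [g] fixes both m+1 and m, and the descent of [pi] would put m+1 before m in [tau],
   against [F3]. *)
have gm1 : g m.+1 = m.+2.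
  have /andP[h1 h2] : m.+1 <= g m.+1 <= m.+2 by apply: gb.
  have /andP[h3 _] : m <= g m <= m.+1 by apply: gb; rewrite (ltnW m1) ltnW.
  move: h2; rewrite leq_eqVlt => /predU1P[//|h2].
  have e1 : g m.+1 = m.+1 by apply/eqP; rewrite eqn_leq h1 -ltnS h2.
  have h4 := gS m (ltnW m1) mn.
  have e2 : g m = m by apply/eqP; rewrite eqn_leq h3 -ltnS -e1 h4.
  by have := gsub _ _ desc; rewrite e1 e2 (negbTE F3).
have ghigh v : m < v <= n -> g v = v.+1.
  clear - gm1 gS gb; elim: v => // v ih h.
  case: (ltngtP v m) => [|vm|->] //; first by lia.
  have e : g v = v.+1 by apply: ih; lia.
  have h1 : g v < g v.+1 by apply: gS; lia.
  by have := gb v.+1; lia.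
pose win v := (m.-1 <= v) && (v <= j).
have kw : keq (filter win pi) (filter win (rev Y ++ X)).
  apply: keq_filter kp => x y z /andP[xy yz] /andP[hx _] /andP[_ hz].
  by rewrite /win (leq_trans hx (ltnW xy)) (leq_trans (ltnW yz) hz).
have uw : uniq (filter win pi) by rewrite filter_uniq // (is_permutation_uniq pp).
(* With second parameter 0, [cross] only asks for an increasing subsequence of length three. The
   hook word has m-1, m, j, and [keq] carries the property to [pi]. *)
have : cross 2 0 (filter win pi).
  apply/(cross_keq 2 0 kw uw); exists j; rewrite filter_cat.
  have subX : subseq [:: m.-1; m; j] (filter win X).
    rewrite subseq_filter subseq_initial // andbT /= /win.
    by clear - m1 mj; lia.
  have {}subX := subseq_trans subX (suffix_subseq (filter win (rev Y)) _).
  split; last by apply: (mem_subseq subX); rewrite !inE eqxx !orbT.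
  exists m; split; [exact: ltnW mj | | exists m.-1; split;
    first by rewrite /= prednK ?leqnn 1?ltnW].
  - by apply: subseq_trans subX; apply: subseq_cons.
  - by apply: subseq_trans subX; apply: (prefix_subseq [:: _; _] [:: _]).
  - by apply: (mem_subseq subX); rewrite inE eqxx.
move=> [r [[q [qr sqr [p [pq spq _]]]] _]].
have [hp hq hr] : [/\ win p, win q & win r].
  move: (subseq2_mem sqr) (subseq2_mem spq); rewrite !mem_filter.
  by move=> /andP[/andP[hq _] /andP[hr _]] /andP[/andP[hp _] _].
have fs := filter_subseq win pi.
have := gsub _ _ (subseq_trans sqr fs); have := gsub _ _ (subseq_trans spq fs).
move: hp hq hr pq qr; rewrite /win => /andP[hp _] _ /andP[_ hr] /= pq qr bpq bqr.
have jn' : j <= n by case/andP: jn.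
apply: (embedding_window gb ghigh F1 F2 m1 jn' hp _ hr bpq bqr).
by rewrite pq qr.
Qed.

(** Compare [X] with the least letter y of [Y]. If [X] has nothing above y, the concatenation is
    sorted; otherwise m is y-1 and j is the first letter of [X] above y. *)
Lemma sorted_cat_disjoint_iota n X Y : sorted ltn X -> sorted ltn Y ->
  perm_eq (X ++ Y) (iota 1 n) ->
  (X = iota 1 (size X) /\ Y = iota (size X).+1 (size Y)) \/
  exists m j Xb, [/\ X = iota 1 m ++ j :: Xb, m.+1 < j
                   & forall v, m < v < j -> v \in Y].
Proof.
move=> sX sY pXY.
have mXY v : (v \in X) || (v \in Y) = (0 < v <= n).
  by rewrite -mem_cat (perm_mem pXY) mem_iota add1n ltnS.
have uXY : uniq (X ++ Y) by rewrite (perm_uniq pXY) iota_uniq.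
case: Y sY pXY mXY uXY => [|y Y] sY pXY mXY uXY.
  by left; apply: sorted_iota_split pXY; rewrite cats0.
have yY : all (ltn y) Y by move: sY; rewrite sorted_ltn_cons => /andP[].
have yn : 0 < y <= n by rewrite -mXY inE eqxx orbT.
have yX : y \notin X.
  by move: uXY; rewrite cat_uniq /= negb_or => /and3P[_ /andP[]].
case e : (filter (leq y) X) (sorted_split y sX) => [|j Xb] eX.
  left; apply: sorted_iota_split pXY; rewrite sorted_ltn_cat sX sY !andbT.
  apply/allrelP => u v uX; rewrite inE.
  have uy : u < y by move: uX; rewrite eX cats0 mem_filter => /andP[].
  by case/predU1P=> [->//|/(allP yY)]; apply: ltn_trans.
have yj : y < j.
  have : j \in filter (leq y) X by rewrite e inE eqxx.
  rewrite mem_filter => /andP[/= yj jX]; rewrite ltn_neqAle yj andbT.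
  by apply: contraNneq yX => ->.
right; exists y.-1, j, Xb; rewrite prednK; last by case/andP: yn.
split=> // [|v /andP[yv vj]].
  rewrite {1}eX; congr (_ ++ _).
  apply: (irr_sorted_eq ltn_trans ltnn) (iota_ltn_sorted _ _) _ => [|v].
    exact/sorted_filter/sX/ltn_trans.
  rewrite mem_filter mem_iota add1n prednK; last by case/andP: yn.
  apply/andP/andP => [[/= vy vX]|[v0 vy]].
    by have := mXY v; rewrite vX /= => /esym/andP[].
  split=> //; have := mXY v; rewrite v0 (ltnW (leq_trans vy (andP yn).2)) inE.
  case/or3P => // [/eqP vy'|/(allP yY) /= yv]; first by rewrite vy' ltnn in vy.
  by rewrite ltnNge ltnW in vy.
have yv' : y <= v by case/andP: yn yv; case: (y).
have vn : 0 < v <= n.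
  have /andP[j0 jn] : 0 < j <= n.
    rewrite -mXY; have : j \in filter (leq y) X by rewrite e inE eqxx.
    by rewrite mem_filter => /andP[_ ->].
  by case/andP: yn => y0 _; rewrite (leq_trans y0) //= (leq_trans (ltnW vj)).
have := mXY v; rewrite vn => /orP[vX|//].
have : v \in filter (leq y) X by rewrite mem_filter /= yv'.
have : sorted ltn (filter (leq y) X) by apply: sorted_filter sX; apply: ltn_trans.
rewrite e sorted_ltn_cons inE => /andP[jXb _] /predU1P[vj'|/(allP jXb) /= jv].
  by rewrite vj' ltnn in vj.
by rewrite ltnNge ltnW in vj.
Qed.

Lemma hook_tableauE P a b : shape P = a :: nseq b 1 ->
  exists row col, [/\ P = hook_tableau row col, size row = a & size col = b].
Proof.
case: P => [//|row T] [<- eT]; exists row, (flatten T).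
have sT : all (fun r : seq nat => size r == 1) T.
  have : all (pred1 1) (shape T) by rewrite eT all_pred1_nseq.
  by rewrite all_map.
split=> //; last by rewrite size_flatten eT sumn_nseq mul1n.
congr (_ :: _); elim: T sT {eT} => //= r T ih /andP[/eqP sr sT].
by case: r sr => [|c [|? ?]] //= _; rewrite -ih.
Qed.

Lemma tab_column_sorted h R col : tab (hook_tableau (h :: R) col) ->
  sorted ltn (h :: col).
Proof.
case=> _ _; elim: col h R => //= c col ih h R [_ hc] [_ _ cc tc].
by rewrite (hc 0) //=; apply: (ih c [::]).
Qed.

Lemma hook_closed_superstandard row col :
  let P := hook_tableau row col in is_syt P ->
  pattern_knuth_closed (knuth_class P) ->
  row <> [::] -> 
  (P = row_hook (size row) (size col)) \/ P = column_hook (size row) (size col).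
Proof.
move=> P sP cl row0; have tP := syt_tab sP.
set n := size (flatten P).
have pF : perm_eq (row ++ col) (iota 1 n).
  have [_ pP _ _] := sP; move: pP; rewrite /is_permutation /is_permutation_of -/n.
  apply: perm_trans; rewrite /= perm_cat2l.
  by elim: (col) => //= c s ih; rewrite perm_cons.
have sR : sorted ltn row by case: tP.
have rwP : is_permutation_of n (reading_word P).
  by case: sP => _ pP _ _; apply: perm_trans pP; apply: perm_reading_word.
case: row row0 @P sP cl tP n pF sR rwP => [//|h R] _ P sP cl tP n pF sR rwP.
have sC := tab_column_sorted tP.
have mP v : (v \in h :: R) || (v \in col) = (0 < v <= n).
  by rewrite -mem_cat (perm_mem pF) mem_iota add1n ltnS.
have hn : 0 < h <= n by rewrite -mP inE eqxx.
have h1 : h = 1.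
  apply/eqP; rewrite eqn_leq; case/andP: (hn) => h0 hn'; rewrite h0 andbT.
  have := mP 1; rewrite (leq_trans h0 hn') inE -orbA => /or3P[/eqP->//|hR|hc].
    move: sR; rewrite sorted_ltn_cons => /andP[/allP/(_ _ hR) /= hlt _].
    exact: ltnW.
  move: sC; rewrite sorted_ltn_cons => /andP[/allP/(_ _ hc) /= hlt _].
  exact: ltnW.
(* If 2 is in the column, the first column plays the role of [X] and words are reversed; otherwise
   the row does. This choice gives [1 < m]. *)
subst h; case: (boolP (2 \in col)) => c2; last first.
  have sc : sorted ltn col by apply: path_sorted sC.
  case: (sorted_cat_disjoint_iota sR sc pF) => [[e1 e2]|[m [j [Xb [eX mj mid]]]]].
    by left; rewrite /row_hook -e1 -e2.
  have m1 : 1 < m.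
    case: m eX mj mid => [|[|//]] eX mj mid; last by rewrite mid in c2.
    by move: eX mj => /= [<-].
  rewrite eX in sR pF.
  have [sigma [tau [ps st sw av]]] := hook_word_obstruction m1 mj sR sc pF mid.
  have rwE : reading_word P = rev col ++ iota 1 m ++ j :: Xb.
    by rewrite reading_word_hook eX.
  rewrite -rwE in sw av.
  have KP : knuth_class P (reading_word P).
    by apply: (keq_knuth_class tP rwP); apply: keq_refl.
  case: (closed_keq cl ps st KP sw) => pi Kpi; apply: av.
    by apply: is_permutation_keq rwP; apply/keq_sym/(knuth_class_keq tP).
  exact: knuth_class_keq.
have sR' : sorted ltn R by apply: path_sorted sR.
have pF' : perm_eq ((1 :: col) ++ R) (iota 1 n).
  by apply: perm_trans pF; rewrite /= perm_cons perm_catC.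
case: (sorted_cat_disjoint_iota sC sR' pF') => [[/= e1 e2]|[m [j [Xb [eX mj mid]]]]].
  by right; rewrite /column_hook -e2; case: e1 => <-.
have uF : uniq ((1 :: col) ++ R) by rewrite (perm_uniq pF') iota_uniq.
have m1 : 1 < m.
  case: m eX mj mid => [|[|//]] eX mj mid; first by move: eX mj => /= [<-].
  move: uF; rewrite cat_uniq => /and3P[_ /hasPn/(_ 2 (mid 2 _)) + _].
  by rewrite /= !inE c2 orbT => /(_ mj).
rewrite eX in sC pF'.
have [sigma [tau [ps st sw av]]] := hook_word_obstruction m1 mj sC sR' pF' mid.
have rwE : rev (reading_word P) = rev R ++ iota 1 m ++ j :: Xb.
  by rewrite reading_word_hook rev_cat revK rev_cons cat_rcons -eX.
rewrite -rwE in sw av.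
have KP : knuth_class P (reading_word P).
  by apply: (keq_knuth_class tP rwP); apply: keq_refl.
have sw' : contains (rev sigma) (reading_word P).
  rewrite -[reading_word P]revK; apply: contains_rev sw.
  by rewrite rev_uniq (is_permutation_uniq rwP).
have ps' : is_permutation_of n.+1 (rev sigma) by rewrite is_permutation_rev.
case: (closed_keq cl ps' (keq_rev st) KP sw') => pi Kpi.
have kpi := knuth_class_keq tP Kpi.
have ppi : is_permutation_of n pi by apply: is_permutation_keq rwP; apply: keq_sym.
have up := is_permutation_uniq ppi.
move=> /(contains_rev up); rewrite revK; apply: av; last exact: keq_rev.
by rewrite is_permutation_rev.
Qed.

(** * Shapes that are not hooks *)

Lemma sorted_gtn_cat s t :
  sorted gtn (s ++ t) = [&& allrel gtn s t, sorted gtn s & sorted gtn t].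
Proof. by rewrite !(sorted_pairwise gtn_trans) pairwise_cat. Qed.

Lemma sorted_gtn_cons x s : sorted gtn (x :: s) = all (gtn x) s && sorted gtn s.
Proof. by rewrite !(sorted_pairwise gtn_trans). Qed.

(** The bottom [h] is removed repeatedly. Let c and r be its neighbours: if [c < r], then [h] hops
    right over the increasing part and joins the descent after the peak; if [r < c], it hops left
    over the decreasing part and joins the ascent before it. The smaller neighbour is the next
    bottom. *)
Lemma valley_peak C h R M :
  sorted gtn (rcons C h) -> sorted ltn (h :: rcons R M) -> all (gtn M) C ->
  uniq (C ++ R) ->
  exists w1 w2, [/\ keq (C ++ h :: rcons R M) (w1 ++ M :: w2),
    sorted ltn (rcons w1 M) & sorted gtn (M :: w2)].
Proof.
move: {2}(size C + size R) (leqnn (size C + size R)) => k.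
elim: k C h R => [|k ih] C h R; case: (lastP C) => [|C' c] sz sC sR CM uCR.
- by exists (h :: R), [::]; rewrite cats1; split=> //; apply: keq_refl.
- by move: sz; rewrite size_rcons.
- by exists (h :: R), [::]; rewrite cats1; split=> //; apply: keq_refl.
have hc : h < c.
  by move: sC; rewrite sorted_gtn_rcons all_rcons => /andP[/andP[]].
have cM : c < M by move: CM; rewrite all_rcons => /andP[].
have sC' : sorted gtn (rcons C' c) by move: sC; rewrite sorted_gtn_rcons => /andP[].
have sR' : sorted ltn (rcons R M) by apply: path_sorted sR.
have hall x : x \in rcons C' c ++ rcons R M -> h < x.
  rewrite mem_cat => /orP[xC|xR].
    by move: sC; rewrite sorted_gtn_rcons => /andP[/allP/(_ _ xC)].
  by move: sR; rewrite sorted_ltn_cons => /andP[/allP/(_ _ xR)].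
case: (ltnP c (head M R)) => cR.
  have sR2 : sorted ltn (c :: rcons R M).
    by case: (R) cR sR' => [|r R'] /= -> //.
  have [|||w1 [w2 [kw sw1 sw2]]] := ih C' c R _ sC' sR2.
  - by move: sz; rewrite size_rcons; lia.
  - by move: CM; rewrite all_rcons => /andP[].
  - move: uCR; rewrite cat_rcons; apply: subseq_uniq.
    by apply: cat_subseq => //; apply: subseq_cons.
  exists w1, (rcons w2 h); split=> //.
    apply: (@keq_trans _ (C' ++ c :: rcons (rcons R M) h)).
      by rewrite cat_rcons; apply/keq_catl; apply: keq_hop_inc.
    by have := keq_catr [:: h] kw; rewrite -!catA /= !cats1.
  rewrite -rcons_cons sorted_gtn_rcons sw2 andbT; apply/allP => x xw.
  apply: hall; rewrite cat_rcons (perm_mem (keq_perm kw)) mem_cat.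
  by rewrite xw orbT.
case: R sz sR CM uCR sR' hall cR => [|r R] sz sR CM uCR sR' hall /= cR.
  by move: cM; rewrite ltnNge cR.
have rc : r < c.
  rewrite ltn_neqAle cR andbT; apply/eqP => rc; move: uCR.
  by rewrite rc cat_rcons cat_uniq => /and3P[_ _] /=; rewrite inE eqxx.
have hr : h < r by apply: hall; rewrite mem_cat inE eqxx orbT.
have sCr : sorted gtn (rcons (rcons C' c) r).
  rewrite sorted_gtn_rcons sC' andbT all_rcons /= rc /=.
  move: sC'; rewrite sorted_gtn_rcons => /andP[+ _]; apply: sub_all => x /= cx.
  exact: ltn_trans cx.
have [||w1 [w2 [kw sw1 sw2]]] := ih (rcons C' c) r R _ sCr sR' CM.
- by move: sz => /=; lia.
- by move: uCR; apply: subseq_uniq; apply: cat_subseq => //; apply: subseq_cons.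
exists (h :: w1), w2; split=> //.
  have /(keq_catr (rcons R M)) := keq_dec_hop hr sCr.
  rewrite -catA /= cat_rcons => h1; apply: keq_trans h1 _.
  by rewrite (cat_rcons r (rcons C' c)); apply: keq_cons.
rewrite -/(rcons (h :: w1) M) [rcons _ _]/= sorted_ltn_cons sw1 andbT;
  apply/allP => x xw; apply: hall.
have : x \in w1 ++ M :: w2 by rewrite -cat_rcons mem_cat xw.
by rewrite -(perm_mem (keq_perm kw)).
Qed.

(* [Cb ++ CM ++ Cl ++ [:: z, h & rcons Rl M ++ Rb]] reads the tableau consisting
   of a hook with first row [h :: rcons Rl M ++ Rb] and first column
   [h :: rev (Cb ++ CM ++ Cl)], together with [z] in the second row and column.
   The column entries above [z], between [M] and [z], and below [M] are [Cb],
   [CM] and [Cl].  The inserted letter [x] lies just above [M]. *)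
Lemma descend_last_column Cb CM Cl h Rl M z Rb x :
  CM <> [::] ->
  sorted gtn (Cb ++ z :: CM ++ x :: M :: rcons Cl h) ->
  sorted ltn (h :: rcons Rl M ++ z :: Rb) ->
  uniq (Cl ++ Rl) ->
  exists alpha beta,
    keq (alpha ++ beta) (Cb ++ CM ++ Cl ++ [:: z, h & rcons Rl M ++ Rb]) /\
    exists d r, [/\ keq (alpha ++ x :: beta) (d ++ r),
                    sorted gtn d & sorted ltn r].
Proof.
move=> CM0 sC sR u.
have [xM Mz xz] : [/\ M < x, M < z & x < z].
  move: sC; rewrite sorted_gtn_cat => /and3P[_ _]; rewrite sorted_gtn_cons.
  rewrite all_cat /= => /andP[/andP[_ /and3P[xz Mz _]]].
  by rewrite sorted_gtn_cat => /and3P[_ _ /= /andP[]].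
have sCl : sorted gtn (rcons Cl h).
  move: sC; rewrite -cat_cons catA -2!cat_rcons.
  by rewrite sorted_gtn_cat => /and3P[].
have Clz : all (gtn M) Cl /\ sorted gtn (M :: rcons Cl h).
  move: sC; rewrite -cat_cons catA -cat_rcons.
  rewrite sorted_gtn_cat => /and3P[_ _ sMC]; split=> //.
  by move: sMC; rewrite sorted_gtn_cons all_rcons => /andP[/andP[]].
have sRl : sorted ltn (h :: rcons Rl M).
  by move: sR; rewrite -cat_cons sorted_ltn_cat => /and3P[].
have [w1 [w2 [kw sw1 sw2]]] := valley_peak sCl sRl Clz.1 u.
(* Without [x], the letter [z] hops left over [w1], back to its cell in the second row. With [x] in
   front of [z], it is [x] that hops left over [w1], while [z] moves right past [M] and [w2] into
   the increasing word. *)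
exists (Cb ++ CM ++ w1), ([:: z, M & w2 ++ Rb]); split.
  have hrz : exists r R', rcons Rl M = r :: R' /\ h < r < z.
    have hM : h < M by move: sRl;
      rewrite -rcons_cons sorted_ltn_rconsE => /andP[/andP[]].
    case: (Rl) sR => [|r R'] sR; [exists M, [::] | exists r, (rcons R' M)]; split=> //.
      by rewrite hM.
    move: sR; rewrite -cat_cons sorted_ltn_cat => /and3P[/allrelP rel /= /andP[-> _] _].
    by apply: rel; rewrite !inE eqxx ?orbT.
  have step_a : keq (Cl ++ [:: z, h & rcons Rl M ++ Rb])
                    (Cl ++ [:: h, z & rcons Rl M ++ Rb]).
    case: hrz => r [R' [-> hrz]]; apply: keq_sym.
    exact: (keq_xzy Cl (R' ++ Rb) hrz).
  have step_b : keq (CM ++ Cl ++ [:: h, z & rcons Rl M ++ Rb])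
                    (CM ++ z :: Cl ++ h :: rcons Rl M ++ Rb).
    case: (lastP CM) CM0 sC => // CM' m _.
    rewrite sorted_gtn_cat => /and3P[_ _]; rewrite sorted_gtn_cons all_cat all_rcons.
    move=> /andP[/andP[/andP[mz _] _]]; rewrite cat_rcons sorted_gtn_cat => /and3P[_ _].
    rewrite -(cat1s m) -(cat1s x) -(cat1s M) 2!catA => mC.
    have {}mC : sorted gtn (m :: rcons Cl h).
      apply: subseq_sorted mC; first exact: gtn_trans.
      by rewrite /= eqxx; apply: (suffix_subseq [:: _; _]).
    have := keq_catr (rcons Rl M ++ Rb) (keq_hop_dec mz mC).
    move/(keq_catl CM')/keq_sym.
    by rewrite !cat_rcons /= !cat_rcons.
  rewrite -!catA; apply: keq_catl; apply: keq_sym.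
  apply: keq_trans (keq_catl CM step_a) _; apply: keq_trans step_b _.
  apply: keq_catl; apply: (@keq_trans _ ((z :: w1 ++ M :: w2) ++ Rb)).
    have := keq_catr Rb (keq_cons z kw).
    by rewrite /= -!catA /=.
  have /(keq_catr (w2 ++ Rb))/keq_sym := keq_inc_hop Mz sw1.
  by rewrite /= -!catA /= cat_rcons.
exists (Cb ++ CM ++ x :: Cl), (h :: rcons Rl M ++ z :: Rb); split=> //.
  rewrite -!catA; do 2!apply: keq_catl.
  apply: (@keq_trans _ (w1 ++ [:: x, M, z & w2 ++ Rb])).
    by apply: keq_sym; apply: keq_yxz; rewrite xM.
  have := keq_catr [:: z & w2 ++ Rb] (keq_inc_hop xM sw1).
  rewrite -!catA /= cat_rcons => h1; apply: keq_trans h1 _; apply: keq_cons.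
  apply: (@keq_trans _ (w1 ++ M :: w2 ++ z :: Rb)).
    have := keq_catr Rb (keq_hop_dec Mz sw2).
    by rewrite /= cat_rcons => /(keq_catl w1).
  by have := keq_catr (z :: Rb) (keq_sym kw); rewrite -!catA.
apply: subseq_sorted sC; first exact: gtn_trans.
apply: cat_subseq => //; apply: subseq_trans (subseq_cons _ _).
apply: cat_subseq => //=; rewrite eqxx; apply: subseq_trans (subseq_cons _ _).
exact: subseq_rcons.
Qed.

(** Reversal exchanges the roles of row and column in [descend_last_column]. It also interchanges
    [z] and [h], which one Knuth move undoes. *)
Lemma descend_last_row Cb N Cl h Rl RM z Rb x :
  RM <> [::] ->
  sorted gtn (Cb ++ z :: N :: rcons Cl h) ->
  sorted ltn (h :: Rl ++ [:: N, x & RM ++ z :: Rb]) ->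
  uniq (Cl ++ Rl) ->
  exists alpha beta,
    keq (alpha ++ beta) (Cb ++ N :: Cl ++ [:: z, h & Rl ++ RM ++ Rb]) /\
    exists d r, [/\ keq (alpha ++ x :: beta) (d ++ r),
                    sorted gtn d & sorted ltn r].
Proof.
move=> RM0 sC sR u.
have [||||alpha [beta [kab [d [r [kdr sd sr]]]]]] :=
  @descend_last_column (rev Rb) (rev RM) (rev Rl) h (rev Cl) N z (rev Cb) x.
- by move/(congr1 rev); rewrite revK.
- have -> : rev Rb ++ z :: rev RM ++ x :: N :: rcons (rev Rl) h
            = rev (h :: Rl ++ [:: N, x & RM ++ z :: Rb]).
    by rewrite -?cats1 ?(rev_cat, rev_cons, rev_rcons, revK) -?cats1 -?catA /= -?catA.
  by rewrite rev_gtn.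
- have -> : h :: rcons (rev Cl) N ++ z :: rev Cb
            = rev (Cb ++ z :: N :: rcons Cl h).
    by rewrite -?cats1 ?(rev_cat, rev_cons, rev_rcons, revK) -?cats1 -?catA /= -?catA.
  by rewrite rev_ltn.
- by rewrite -rev_cat rev_uniq.
exists (rev beta), (rev alpha); split.
  rewrite -rev_cat; apply: keq_trans (keq_rev kab) _.
  rewrite -?cats1 ?(rev_cat, rev_cons, rev_rcons, revK) -?cats1 -?catA /= -?catA.
  case e : (Rl ++ RM) => [|r' R']; first by case: (Rl) (RM) e RM0 => [|? ?] [].
  have r'in : r' \in Rl ++ RM by rewrite e inE eqxx.
  have hrz : h < r' < z.
    move: sR; rewrite sorted_ltn_cons => /andP[/allP hall].
    rewrite -2!cat_cons catA sorted_ltn_cat => /and3P[/allrelP rel _ _].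
    apply/andP; split.
      by apply: hall; move: r'in; rewrite !mem_cat !inE mem_cat => /orP[->|->];
        rewrite ?orbT.
    apply: rel; last by rewrite inE eqxx.
    by move: r'in; rewrite !mem_cat !inE => /orP[->|->]; rewrite ?orbT.
  rewrite (catA Rl) e /=.
  have := keq_xzy (Cb ++ N :: Cl) (R' ++ Rb) hrz.
  by rewrite -!catA.
exists (rev r), (rev d); split; rewrite ?rev_gtn ?rev_ltn //.
by have := keq_rev kdr; rewrite !rev_cat rev_cons cat_rcons.
Qed.

Lemma sorted_gtn_insert s y t : sorted gtn (s ++ t) ->
  all (ltn y) s -> all (gtn y) t -> sorted gtn (s ++ y :: t).
Proof.
rewrite !sorted_gtn_cat sorted_gtn_cons allrel_consr.
by move=> /and3P[-> -> ->] ys ->; rewrite !andbT.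
Qed.

Lemma sorted_ltn_insert s y t : sorted ltn (s ++ t) ->
  all (gtn y) s -> all (ltn y) t -> sorted ltn (s ++ y :: t).
Proof.
rewrite !sorted_ltn_cat sorted_ltn_cons allrel_consr.
by move=> /and3P[-> -> ->] ys ->; rewrite !andbT.
Qed.

Lemma sorted_gtn_split y s : sorted gtn s -> y \notin s ->
  s = filter (ltn y) s ++ filter (gtn y) s.
Proof.
rewrite -rev_ltn => /(sorted_split y)/(congr1 rev); rewrite revK rev_cat.
rewrite !filter_rev !revK => e ys; rewrite {1}e; congr (_ ++ _);
  apply: eq_in_filter => v vs /=.
by rewrite leq_eqVlt; case: eqP ys => // ->; rewrite vs.
Qed.

Lemma sorted_ltn_split y s : sorted ltn s -> y \notin s ->
  s = filter (gtn y) s ++ filter (ltn y) s.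
Proof.
move=> /(sorted_split y) e ys; rewrite {1}e; congr (_ ++ _);
  apply: eq_in_filter => v vs /=.
by rewrite leq_eqVlt; case: eqP ys => // ->; rewrite vs.
Qed.

Lemma even_gap M v : ~~ odd M -> ~~ odd v -> M < v -> M.+1 < v.
Proof. by move=> oM ov; rewrite leq_eqVlt => /predU1P[e|//];
  rewrite -e /= oM in ov. Qed.

(* Applied to words with even letters only, so that [x] is a new letter. *)
Definition insertable p q (w : seq nat) :=
  exists x alpha beta, [/\ odd x, keq (alpha ++ beta) w
    & exists2 w', keq (alpha ++ x :: beta) w' & dec_inc_pieces p q w'].

(** [M] and [N] are the largest entries below [z] in the row and in the column, leaving out the
    corner [h]. The new letter goes just above the smaller of the two: into the column if [M < N],
    into the row if [N < M]. *)
Lemma insertable_hook_corner C z h r R :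
  sorted gtn (rcons C h) -> sorted ltn (h :: r :: R) ->
  has (gtn z) C -> r < z -> all (fun v => ~~ odd v) (C ++ z :: h :: r :: R) ->
  uniq (C ++ z :: h :: r :: R) ->
  insertable 1 1 (C ++ z :: h :: r :: R).
Proof.
move=> sC sR hasC rz ev un.
pose in_all v := v \in C ++ z :: h :: r :: R.
have sC' : sorted gtn C by move: sC; rewrite sorted_gtn_rcons => /andP[].
have Ch v : v \in C -> h < v.
  by move: sC; rewrite sorted_gtn_rcons => /andP[/allP hC _]; apply: hC.
have Rh v : v \in r :: R -> h < v.
  by move: sR; rewrite sorted_ltn_cons => /andP[/allP hR _]; apply: hR.
have sR' : sorted ltn (r :: R) by apply: path_sorted sR.
have zC : z \notin C.
  by move: un; rewrite cat_uniq /= negb_or => /and3P[_ /andP[]].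
have zR : z \notin h :: r :: R by move: un; rewrite cat_uniq /= => /and3P[_ _ /andP[]].
have CR v : v \in C -> v \notin r :: R.
  move=> vC; move: un; rewrite cat_uniq => /and3P[_ /hasPn d _].
  by apply/negP => vR; have := d v; rewrite 2!inE vR !orbT vC => /(_ isT).
have hz : h < z by apply: ltn_trans rz; apply: Rh; rewrite inE eqxx.
have eC := sorted_gtn_split sC' zC.
have zR' : z \notin r :: R by move: zR; rewrite inE negb_or => /andP[].
have eR := sorted_ltn_split sR' zR'.
have evC v : v \in C -> ~~ odd v by move=> vC; apply: (allP ev); rewrite mem_cat vC.
have evR v : v \in r :: R -> ~~ odd v.
  by move=> vC; apply: (allP ev); rewrite mem_cat 2!inE vC !orbT.
move: eC; set Cb := filter (ltn z) C; case eCw : (filter (gtn z) C) => [|N Cl] eC.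
  by move: hasC; rewrite has_filter eCw.
move: eR; set Rb := filter (ltn z) (r :: R).
case/lastP eRw : (filter (gtn z) (r :: R)) => [|Rl M] eR.
  by move: eRw; rewrite /= rz.
have [NC Nz] : N \in C /\ N < z.
  have : N \in filter (gtn z) C by rewrite eCw inE eqxx.
  by rewrite mem_filter => /andP[].
have [MR Mz] : M \in r :: R /\ M < z.
  have : M \in filter (gtn z) (r :: R) by rewrite eRw mem_rcons inE eqxx.
  by rewrite mem_filter => /andP[].
have NM : N != M by apply: contraNneq (CR N NC) => ->.
have Cbz v : v \in Cb -> z < v by rewrite mem_filter => /andP[].
have Rbz v : v \in Rb -> z < v by rewrite mem_filter => /andP[].
have Cw v : v \in N :: Cl -> v < z /\ v \in C.
  by rewrite -eCw mem_filter => /andP[].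
have Rw v : v \in rcons Rl M -> v < z /\ v \in r :: R.
  by rewrite -eRw mem_filter => /andP[].
have sCw : sorted gtn (N :: Cl) by rewrite -eCw; apply: sorted_filter sC';
  apply: gtn_trans.
have sRw : sorted ltn (rcons Rl M) by rewrite -eRw; apply: sorted_filter sR';
  apply: ltn_trans.
have uCR (A B : seq nat) : subseq A C -> subseq B (r :: R) -> uniq (A ++ B).
  move=> AC BR; move: un; apply: subseq_uniq; apply: cat_subseq => //.
  by apply: subseq_trans BR _; apply: (suffix_subseq [:: z; h]).
have szR : sorted ltn (h :: rcons Rl M ++ z :: Rb).
  apply: (@sorted_ltn_insert (h :: rcons Rl M)); first by rewrite /= -eR.
    by rewrite /= hz; apply/allP => v /Rw[].
  by apply/allP => v /Rbz.
have szC : sorted gtn (Cb ++ z :: rcons (N :: Cl) h).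
  apply: sorted_gtn_insert; first by rewrite -rcons_cat -eC.
    by apply/allP => v /Cbz.
  rewrite all_rcons; apply/andP; split; first exact: hz.
  by apply/allP => v /Cw[].
have evz : ~~ odd z by apply: (allP ev); rewrite mem_cat inE eqxx orbT.
have CbC v : v \in Cb -> v \in C by rewrite mem_filter => /andP[].
case: (ltngtP M N) NM => // [MN|NM] _.
  have MCw : M \notin N :: Cl.
    by apply: contraL MR => /Cw[_ /CR].
  have := sorted_gtn_split sCw MCw.
  set CM := filter (ltn M) _; set Cl' := filter (gtn M) _ => eCw'.
  have [||||alpha [beta [kab [d [w [kx sd sw]]]]]] :=
    @descend_last_column Cb CM Cl' h Rl M z Rb M.+1.
  - by rewrite /CM /= MN.
  - have CMM v : v \in CM -> M < v /\ v \in C.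
      by rewrite mem_filter => /andP[Mv /Cw[]].
    have ClM v : v \in Cl' -> v < M by rewrite mem_filter => /andP[].
    have hM : h < M by apply: Rh.
    have CbM : all (ltn M) (Cb ++ z :: CM).
      rewrite all_cat /= Mz; apply/andP; split; apply/allP => v.
        by move/Cbz; apply: ltn_trans.
      by case/CMM.
    rewrite -cat_cons catA; apply: sorted_gtn_insert.
    + apply: sorted_gtn_insert => //.
        by move: szC; rewrite eCw' rcons_cat -catA.
      rewrite all_rcons; apply/andP; split; first exact: hM.
      by apply/allP => v /ClM.
    + apply/allP => v vin; apply: even_gap (allP CbM _ vin); first exact: evR.
      move: vin; rewrite mem_cat inE => /or3P[/CbC|/eqP->|/CMM[_]] //; exact: evC.
    + rewrite /= ltnSn all_rcons /= (ltn_trans hM) //=; apply/allP => v /ClM /= vM.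
      exact: ltn_trans vM _.
  - exact: szR.
  - apply: uCR; last first.
      by apply: subseq_trans (subseq_rcons _ M) _; rewrite -eRw filter_subseq.
    apply: subseq_trans (filter_subseq _ _) _; rewrite -eCw; exact: filter_subseq.
  exists M.+1, alpha, beta; split.
  + by rewrite /= evR.
  + by move: kab; rewrite eC eR -!catA eCw' -!catA.
  + exists (d ++ w) => //; exists [:: d], [:: w].
    by rewrite /= sd sw !cats0.
have NRw : N \notin rcons Rl M.
  by apply/negP => /Rw[_]; apply/negP/CR.
have := sorted_ltn_split sRw NRw.
set Rl' := filter (gtn N) _; set RM := filter (ltn N) _ => eRw'.
have [||||alpha [beta [kab [d [w [kx sd sw]]]]]] :=
  @descend_last_row Cb N Cl h Rl' RM z Rb N.+1.
- by rewrite /RM filter_rcons /= NM; case: (filter _ _).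
- exact: szC.
- have RMN v : v \in RM -> [/\ N < v, v < z & v \in r :: R].
    by rewrite mem_filter => /andP[Nv /Rw[]].
  have RlN v : v \in Rl' -> v < N by rewrite mem_filter => /andP[].
  have hN : h < N by apply: Ch.
  have NRM : all (ltn N) (RM ++ z :: Rb).
    rewrite all_cat /= Nz; apply/andP; split; apply/allP => v; first by case/RMN.
    by move/Rbz; apply: ltn_trans.
  rewrite -cat_cons; apply: sorted_ltn_insert.
  + apply: sorted_ltn_insert.
    * by move: szR; rewrite eRw' -catA.
    * rewrite /= (ltn_trans hN) //=; apply/allP => v /RlN /= vN.
      exact: ltn_trans vN _.
    * apply/allP => v vin; apply: even_gap (allP NRM _ vin); first exact: evC.
      move: vin; rewrite mem_cat inE => /or3P[/RMN[]|/eqP->|] //;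
        first by move=> _ _ /evR.
      by rewrite mem_filter => /andP[_ /evR].
  + rewrite /= hN; apply/allP => v /RlN; exact.
  + rewrite /= ltnSn; apply/allP => v; exact: (allP NRM).
- apply: uCR; last first.
    by apply: subseq_trans (filter_subseq _ _) _; rewrite -eRw filter_subseq.
  apply: subseq_trans (subseq_cons _ N) _; rewrite -eCw; exact: filter_subseq.
exists N.+1, alpha, beta; split.
+ by rewrite /= evC.
+ by move: kab; rewrite eC eR eRw' -!catA.
+ exists (d ++ w) => //; exists [:: d], [:: w].
  by rewrite /= sd sw !cats0.
Qed.

(** * From one corner to the whole tableau *)

Lemma insertable_dec_prefix p q w D W : sorted gtn D -> keq (D ++ w) W ->
  insertable p q w -> insertable p.+1 q W.
Proof.
move=> sD DW [x [alpha [beta [ox kw [w' kx [ds [rs [ew <- <- sds srs]]]]]]]].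
rewrite ew in kx.
exists x, (D ++ alpha), beta; split=> //.
  by rewrite -catA; apply: keq_trans DW; apply: keq_catl.
exists (D ++ flatten ds ++ flatten rs); first by rewrite -catA; apply: keq_catl.
by exists (D :: ds), rs; rewrite /= sD sds catA.
Qed.

Lemma insertable_inc_suffix p q w rows : all (sorted ltn) rows ->
  insertable p q w -> insertable p (q + size rows) (w ++ flatten rows).
Proof.
move=> srows [x [alpha [beta [ox kw [w' kx [ds [rs [ew <- <- sds srs]]]]]]]].
rewrite ew in kx.
exists x, alpha, (beta ++ flatten rows); split=> //.
  by rewrite catA; apply: keq_catr.
exists ((flatten ds ++ flatten rs) ++ flatten rows).
  by rewrite -cat_cons catA; apply: keq_catr.
by exists ds, (rs ++ rows); rewrite size_cat all_cat srs srows flatten_cat catA.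
Qed.

(** The first letter of [R1] hops left over the rest of [R2], with the first letter of [R2] as
    witness. This splits off the first column as one decreasing word and leaves two rows shortened
    by a cell, until the second row has two cells. *)
Lemma insertable_two_rows R1 R2 Cs : sorted ltn R1 -> sorted ltn R2 ->
  row_above R1 R2 -> 1 < size R2 -> sorted gtn (rcons Cs (head 0 R2)) ->
  all (fun v => ~~ odd v) (Cs ++ R2 ++ R1) -> uniq (Cs ++ R2 ++ R1) ->
  insertable (size R2).-1 1 (Cs ++ R2 ++ R1).
Proof.
elim: R2 R1 Cs => // c R2 ih [|h R1] Cs sR1 sR2 [sz ab] // sz2 sCs ev un.
have {}sCs : sorted gtn (rcons Cs c) by [].
have hc : h < c by apply: (ab 0).
have ab' : row_above R1 R2 by split=> // j; apply: (ab j.+1).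
have sC : sorted gtn (rcons (rcons Cs c) h).
  rewrite sorted_gtn_rcons sCs andbT all_rcons; apply/andP; split=> //.
  move: sCs; rewrite sorted_gtn_rcons => /andP[/= + _]; apply: sub_all => v /=.
  exact: ltn_trans.
case: (ltnP 1 (size R2)) => sz3; last first.
  case: R2 {ih} sz sz2 sz3 ab ab' sR2 ev un => [|z [|? ?]] //.
  case: R1 sR1 => [|r R1] sR1 // _ _ _ ab _ sR2 ev un.
  have := @insertable_hook_corner (rcons Cs c) z h r R1.
  rewrite cat_rcons; apply=> //.
    by rewrite has_rcons /=; move: sR2 => /= /andP[->].
  exact: (ab 1).
case: R2 sz sz2 sR2 ev un ih ab ab' sz3 => [|d R2] // sz sz2 sR2 ev un ih ab ab' sz3.
apply: (@insertable_dec_prefix (size R2) 1 ((d :: R2) ++ R1) (rcons (rcons Cs c) h))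
  => //.
  rewrite !cat_rcons; apply: keq_catl.
  have := keq_catr R1 (keq_hop_inc hc sR2).
  by rewrite /= cat_rcons.
have sub : subseq ((d :: R2) ++ R1) (Cs ++ (c :: d :: R2) ++ h :: R1).
  apply: subseq_trans (suffix_subseq _ _);
    apply: (@subseq_trans _ ((d :: R2) ++ h :: R1)).
    by apply: cat_subseq => //; apply: subseq_cons.
  exact: subseq_cons.
apply: (ih R1 [::]) => //.
- exact: path_sorted sR1.
- exact: path_sorted sR2.
- by apply/allP => v /(mem_subseq sub)/(allP ev).
- exact: subseq_uniq un.
Qed.

(** Halving [alpha ++ beta] gives a member of K(P). Standardising [s] and [w] gives equivalent
    permutations, the first containing that member; any pattern in the second inherits the pieces of
    [w], so row [q] of its tableau has at most [p] cells. *)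
Lemma insertable_not_closed P p q : is_syt P -> p < size (nth [::] P q) ->
  insertable p q (map double (reading_word P)) ->
  ~ pattern_knuth_closed (knuth_class P).
Proof.
move=> sP pq [x [alpha [beta [ox kab [w kx pcs]]]]] cl.
have tP := syt_tab sP; have rwP := syt_reading_word sP.
have urw := is_permutation_uniq rwP.
set s := alpha ++ x :: beta in kx.
have evab v : v \in alpha ++ beta -> ~~ odd v.
  by rewrite (perm_mem (keq_perm kab)) => /mapP[u _ ->]; rewrite odd_double.
have uab : uniq (alpha ++ beta).
  by rewrite (perm_uniq (keq_perm kab)) map_inj_uniq //; apply: double_inj.
have us : uniq s.
  rewrite /s uniq_catC cons_uniq uniq_catC uab andbT mem_cat orbC -mem_cat.
  by apply: contraL ox => /evab.
have rm := @rank_mono s; pose r := rank s.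
have hab : map double (map half (alpha ++ beta)) = alpha ++ beta.
  rewrite -map_comp; apply: map_id_in => v /evab ov /=.
  by rewrite -[RHS]odd_double_half (negbTE ov).
pose pi := map half (alpha ++ beta).
have kpi : keq pi (reading_word P).
  have -> : reading_word P = map half (map double (reading_word P)).
    by rewrite -map_comp map_id_in // => v _ /=; rewrite doubleK.
  apply: keq_map kab => u v /evab ou /evab ov.
  by rewrite -ltn_double -[in RHS](odd_double_half u) -[in RHS](odd_double_half v)
             (negbTE ou) (negbTE ov).
have ppi : is_permutation_of (size (reading_word P)) pi.
  exact: is_permutation_keq (keq_sym kpi) rwP.
have Kpi : knuth_class P pi by apply: keq_knuth_class ppi kpi.
have ksw : keq (map r s) (map r w) by apply: keq_map kx.
have sub : subseq (alpha ++ beta) s by apply: cat_subseq => //; apply: subseq_cons.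
have cpi : contains (map r s) pi.
  apply: (contains_map (g := r \o double)).
    by rewrite map_comp hab; apply: map_subseq.
  move=> u v upi vpi /=; rewrite rm ?ltn_double //.
    by apply: (mem_subseq sub); rewrite -hab; apply: map_f.
  by apply: (mem_subseq sub); rewrite -hab; apply: map_f.
apply: (closed_keq cl (is_permutation_rank us) ksw Kpi cpi) => pi' Kpi' ctr.
have upi' := is_permutation_uniq Kpi'.1.
have [g gsub gm] := contains_embedding upi' ctr.
have pcs' : dec_inc_pieces p q (map g pi').
  apply: dec_inc_pieces_subseq gsub _; apply: dec_inc_pieces_map pcs => u v.
  by rewrite -!(perm_mem (keq_perm kx)); apply: rm.
have iso : order_isomorphic (map g pi') pi'.
  exact/order_isomorphic_sym/map_order_isomorphic.
have ug : uniq (map g pi') by rewrite (map_inj_in_uniq (ltn_mono_inj_in gm)).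
have [f ef fm] := order_isomorphic_map ug iso.
have := size_row_dec_inc_pieces upi'; rewrite Kpi'.2 => /(_ p q).
rewrite leqNgt pq => h; have : false; last by [].
by apply: h; rewrite ef; apply: dec_inc_pieces_map.
Qed.

Lemma tab_catr A B : tab (A ++ B) -> tab B.
Proof. by elim: A => //= r A ih [_ _ _ /ih]. Qed.

Lemma tab_long_rows T : tab T -> exists A L,
  [/\ T = A ++ L, all (fun r => 1 < size r) A & all (fun r => size r == 1) L].
Proof.
elim: T => [|r T ih]; first by exists [::], [::].
move=> [sr r0 [sz _] /ih[A [L [eT hA hL]]]].
case: (ltnP 1 (size r)) => szr; first by exists (r :: A), L; rewrite /= szr hA eT.
have sr1 : size r == 1 by case: (r) r0 szr => [|? [|]].
exists [::], (r :: T); split=> //; rewrite /= sr1 eT /=.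
case: A eT hA => [//|s A] eT /= /andP[szs _].
by move: sz; rewrite eT /= => /(leq_trans szs); rewrite (eqP sr1).
Qed.

Lemma singleton_rows (L : tableau) : all (fun r => size r == 1) L ->
  L = [seq [:: c] | c <- flatten L].
Proof.
elim: L => //= r L ih /andP[/eqP sr /ih {1}->].
by case: r sr => [|c [|]].
Qed.

Lemma reading_word_cat A B : reading_word (A ++ B) = reading_word B ++ reading_word A.
Proof. by rewrite /reading_word rev_cat flatten_cat. Qed.

Lemma reading_word_singletons col :
  reading_word [seq [:: c] | c <- col] = rev col.
Proof. by have := reading_word_hook [::] col; rewrite reading_word_cons !cats0. Qed.

(** [R2] is the last row with more than one cell, so it ends in a corner, and its index from 0 is
    [1 + size U]. The rows of [U], read last, supply the remaining increasing words. *)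
Lemma two_long_rows_not_closed U R1 R2 L :
  let P := U ++ [:: R1, R2 & L] in is_syt P ->
  1 < size R2 -> all (fun r => size r == 1) L ->
  ~ pattern_knuth_closed (knuth_class P).
Proof.
move=> P sP szR2 /singleton_rows; set col := flatten L => eL.
have tP := syt_tab sP; have [sR1 _ ab [sR2 _ _ _]] := tab_catr tP.
have tR2 : tab (hook_tableau R2 col).
  by have := tab_catr tP; rewrite eL => -[_ _ _].
have sdbl u v : (u.*2 < v.*2) = (u < v) by rewrite ltn_double.
have dm s : sorted ltn (map double s) = sorted ltn s /\
            sorted gtn (map double s) = sorted gtn s.
  by apply: (sorted_map_mono (P := predT)); rewrite ?all_predT // => u v _ _.
have rwE : reading_word P = (rev col ++ R2 ++ R1) ++ flatten (rev U).
  rewrite reading_word_cat !reading_word_cons {1}eL reading_word_singletons.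
  by rewrite -!catA.
have urw := is_permutation_uniq (syt_reading_word sP).
have uw : uniq (rev col ++ R2 ++ R1).
  by apply: subseq_uniq urw; rewrite rwE; apply: prefix_subseq.
have nthP : nth [::] P (1 + size U) = R2.
  by rewrite /P nth_cat add1n ltnNge leqnSn subSnn.
apply: (@insertable_not_closed P (size R2).-1 (1 + size U) sP).
  by rewrite nthP; case: (size R2) szR2.
have -> : map double (reading_word P) =
    (map double (rev col) ++ map double R2 ++ map double R1)
    ++ flatten (map (map double) (rev U)).
  by rewrite rwE !map_cat map_flatten.
have := @insertable_inc_suffix (size R2).-1 1 _ (map (map double) (rev U)).
rewrite size_map size_rev; apply.
  rewrite all_map all_rev; apply/allP => r rU /=; rewrite (dm r).1.
  by apply: (allP (tab_rows tP)); rewrite mem_cat rU.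
rewrite -(size_map double R2); apply: insertable_two_rows.
- by rewrite (dm R1).1.
- by rewrite (dm R2).1.
- case: ab => sz ab; split; rewrite !size_map // => j js.
  by rewrite !(nth_map 0) ?sdbl ?ab // (leq_trans js).
- by rewrite size_map.
- case: (R2) tR2 szR2 => [//|h R] tR2 _; rewrite /= -map_rcons (dm _).2.
  by rewrite -rev_cons rev_gtn; apply: tab_column_sorted tR2.
- rewrite -!map_cat all_map; apply/allP => v _ /=; by rewrite odd_double.
- by rewrite -!map_cat map_inj_uniq //; apply: double_inj.
Qed.

(** The class of the empty tableau consists of the empty word, which every permutation contains; it
    is closed, but the empty shape is not a hook. *)
Theorem theorem5p8 (P : tableau) (hP : is_syt P) (hP0 : P <> [::]) :
  pattern_knuth_closed (knuth_class P) <->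
  is_superstandard P /\ is_hook (shape P).
Proof.
have tP := syt_tab hP; split=> [cl|[ss [a [b [a0 eP]]]]]; last first.
  move: ss; rewrite /is_superstandard eP row_superstandard_hook.
  rewrite column_superstandard_hook // => -[e|e]; rewrite e in tP *.
    exact: row_hook_closed.
  exact: column_hook_closed.
have [A [L [eP hA hL]]] := tab_long_rows tP.
(* [A] holds the rows with more than one cell: with at most one of them the shape is a hook, and
   otherwise the last two contradict closure. *)
have [a [b [a0 eS]]] : is_hook (shape P).
  have LE : shape L = nseq (size L) 1.
    by rewrite -(size_map size L); apply/all_pred1P; rewrite all_map.
  case: (lastP A) eP hA => [|A' R2] eP hA.
    rewrite eP in hP0 *; case: (L) hP0 LE => // r L' _ LE.
    by exists 1, (size L').
  case: (lastP A') eP hA => [|U R1] eP hA.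
    exists (size R2), (size L); split; last by rewrite eP /= LE.
    by move: hA => /=; case: (size R2).
  exfalso; move: hP cl hA; rewrite eP !cat_rcons all_rcons => hP' cl /andP[h _].
  exact: (two_long_rows_not_closed hP' h hL) cl.
split; last by exists a, b.
have [row [col [eR sa sb]]] := hook_tableauE eS.
have row0 : row <> [::] by move=> e; rewrite -sa e in a0.
rewrite /is_superstandard eS row_superstandard_hook column_superstandard_hook //.
rewrite -sa -sb eR; rewrite eR in hP cl.
exact: hook_closed_superstandard hP cl row0.
Qed.
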